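(* Let $H$ be a forest with connected components the trees $T_1,\dots,T_k$, and let $b$ be a positive integer. Consider $(1:b)$ Client-Waiter vertex games. (1) If $H$ is a tree ($k=1$), there exists a tree $T$ such that Client wins the $(1:b)$ Client-Waiter vertex $H$-game played on $T$. (2) For each $i\in[k]$ let $T^{(i)}_{\min}$ be a tree with the minimum number of vertices such that Client wins the $(1:b)$ Client-Waiter vertex $T_i$-game played on it, and let $T_{\max}$ be one of the trees $T^{(i)}_{\min}$ with the maximum number of vertices; write $v=v(T_{\max})$, $e=e(T_{\max})$. Then for $G\sim G(n,p)$: if $p=\omega(n^{-v/e})$ then w.h.p. Client wins the $(1:b)$ Client-Waiter vertex $H$-game on $G$, and if $p=o(n^{-v/e})$ then w.h.p. Waiter wins it.
   Context: The $(1:b)$ Client-Waiter vertex $H$-game on a graph $G$: in each round Waiter offers a set of $t$ previously unclaimed vertices with $1\le t\le b+1$; Client claims one of them and Waiter claims the rest; in the last round Client claims one of the remaining vertices and Waiter the rest. Client wins if the subgraph of $G$ induced by his vertices contains a (not necessarily induced) copy of $H$; otherwise Waiter wins. $G(n,p)$ is the binomial random graph; ''w.h.p.'' means with probability tending to 1 as $n\to\infty$.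
   Formalization: Part (2) is stated for forests H with at least one edge; for an edgeless H every minimal tree is a single vertex, so e(T_max)=0 and n^{-v/e} is undefined. *)

(* Defs.v *)
From Stdlib Require Import Reals.
From mathcomp Require Import all_boot.
Set Implicit Arguments. Unset Strict Implicit. Unset Printing Implicit Defensive.

Definition simple_graph (V : finType) (e : rel V) : Prop :=
  (forall x y, e x y = e y x) /\ (forall x, e x x = false).

Definition has_cycle (V : finType) (e : rel V) : Prop :=
  exists s : seq V, [/\ uniq s, 3 <= size s & cycle e s].

Definition is_forest (V : finType) (e : rel V) : Prop :=
  simple_graph e /\ ~ has_cycle e.

Definition is_tree (V : finType) (e : rel V) : Prop :=
  is_forest e /\ 0 < #|V| /\ (forall x y, connect e x y).

Definition nedges (V : finType) (e : rel V) : nat :=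
  #|[set p : V * V | e p.1 p.2]| %/ 2.

Definition component (V : finType) (e : rel V) (x : V) : {set V} :=
  [set y | connect e x y].

(* The host graph (VG, eG) restricted to the vertex set C contains a (not
   necessarily induced) copy of the subgraph of (VH, eH) induced on A. *)
Definition has_copy (VH : finType) (eH : rel VH) (A : {set VH})
    (VG : finType) (eG : rel VG) (C : {set VG}) : bool :=
  [exists f : {ffun VH -> VG},
     [forall x in A, f x \in C] &&
     [forall x in A, forall y in A,
        ((f x == f y) ==> (x == y)) && (eH x y ==> eG (f x) (f y))]].

(* (1:b) Client-Waiter vertex game.  State: Client's vertices C, free vertices F.
   While F is nonempty, Waiter offers O ⊆ F with 1 <= |O| <= b+1, Client claims
   one x ∈ O and Waiter claims O \ {x}.  Client wins iff at the end his
   vertices contain a copy of the target.  [fuel] bounds the number of rounds. *)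
Fixpoint cw_client_wins (b : nat) (VH : finType) (eH : rel VH) (A : {set VH})
    (VG : finType) (eG : rel VG) (fuel : nat) (C F : {set VG}) : bool :=
  match fuel with
  | 0 => has_copy eH A eG C
  | fuel'.+1 =>
      if F == set0 then has_copy eH A eG C
      else [forall O : {set VG},
              ((O \subset F) && (0 < #|O| <= b.+1)) ==>
              [exists x in O, cw_client_wins b eH A eG fuel' (x |: C) (F :\: O)]]
  end.

Definition client_wins (b : nat) (VH : finType) (eH : rel VH) (A : {set VH})
    (VG : finType) (eG : rel VG) : bool :=
  cw_client_wins b eH A eG #|VG| set0 setT.

Definition min_winning_tree (b : nat) (VH : finType) (eH : rel VH) (A : {set VH})
    (VT : finType) (eT : rel VT) : Prop :=
  [/\ is_tree eT, client_wins b eH A eT &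
      forall (VT' : finType) (eT' : rel VT'),
        is_tree eT' -> client_wins b eH A eT' -> #|VT| <= #|VT'| ].

Definition epair (n : nat) := {p : 'I_n * 'I_n | (p.1 < p.2)%N}.

Definition gadj (n : nat) (E : {set epair n}) : rel 'I_n :=
  fun i j => [exists u in E,
                (((val u).1 == i) && ((val u).2 == j)) ||
                (((val u).1 == j) && ((val u).2 == i))].

Definition gnp_prob (n : nat) (p : R) (Q : pred {set epair n}) : R :=
  \big[Rplus/R0]_(E : {set epair n} | Q E)
     Rmult (pow p #|E|) (pow (Rminus R1 p) (subn #|[set: epair n]| #|E|)).

Definition whp (Q : forall n : nat, pred {set epair n}) (p : nat -> R) : Prop :=
  Un_cv (fun n => @gnp_prob n (p n) (Q n)) R1.

Definition little_omega (p f : nat -> R) : Prop :=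
  forall M : R, Rlt R0 M ->
    exists N : nat, forall n, (N <= n)%nat -> Rle (Rmult M (f n)) (p n).
Definition little_o (p f : nat -> R) : Prop :=
  forall eps : R, Rlt R0 eps ->
    exists N : nat, forall n, (N <= n)%nat -> Rle (p n) (Rmult eps (f n)).

Definition threshold (v e : nat) : nat -> R :=
  fun n => Rpower (INR n) (Ropp (Rdiv (INR v) (INR e))).

Definition prob_bounds (p : nat -> R) : Prop :=
  forall n, Rle R0 (p n) /\ Rle (p n) R1.

(* Main.v *)
Require Import Defs.
From Stdlib Require Import Reals Classical.
From mathcomp Require Import all_boot all_order all_algebra.
From mathcomp Require Import zify ring.
From mathcomp Require Import Rstruct.
Set Implicit Arguments. Unset Strict Implicit. Unset Printing Implicit Defensive.

(** Part (1).  Build H by adding leaves.  If Client wins for H - x on T, with x a leaf,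
    attach many leaves to every vertex of T.  Client always answers inside T when T is
    touched; only boundedly many rounds are spent that way, so he can still claim a
    leaf at every vertex of T, and one of these extends his copy of H - x.

    Part (2).  Let T_max have m edges, hence m+1 vertices.  If p << n^(-(m+1)/m), a
    first moment computation shows that w.h.p. every component of G(n,p) is a tree on
    at most m vertices.  Waiter plays the components one by one, and by minimality of
    T_max Client gets a copy of the critical component of H in none of them.

    If p >> n^(-(m+1)/m), a second moment computation yields any constant number of
    disjoint copies of every minimal winning tree.  Offers may meet several of these
    boards at once.  Giving weight (b+1)^(number of Client's vertices) to a board that
    Client still wins, an answer in the heaviest touched board does not decrease the
    total weight of one kind of boards; ranking the kinds and taking many more boards
    of each next kind, Client wins on some board of every kind. *)

(** * Finite sets and counting *)

Section FiniteSets.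
Variable V : finType.
Implicit Types (A C D F O : {set V}).

Lemma setIU1_in D C x : x \in D -> (x |: C) :&: D = x |: (C :&: D).
Proof. by move=> xD; rewrite setIUl (setIidPl _) ?sub1set. Qed.

Lemma setIU1_out D C x : x \notin D -> (x |: C) :&: D = C :&: D.
Proof.
by move=> xD; rewrite setIUl (disjoint_setI0 (_ : [disjoint [set x] & D])) ?set0U ?disjoints1.
Qed.

Lemma setIDl D F O : (F :\: O) :&: D = (F :&: D) :\: (O :&: D).
Proof. by apply/setP => y; rewrite !inE; do !case: (y \in _). Qed.

Lemma disjointU1D C F O x : [disjoint C & F] -> x \in O -> [disjoint x |: C & F :\: O].
Proof.
move=> dCF xO; rewrite -setI_eq0 setIUl setU_eq0 !setI_eq0 disjoints1 inE xO /=.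
exact: disjointWr (subsetDl _ _) dCF.
Qed.

Lemma exists_subset_card A n : n <= #|A| ->
  exists2 B : {set V}, B \subset A & #|B| = n.
Proof.
move/card_geqP=> [s [us <- sA]]; exists [set x in s].
  by apply/subsetP => x; rewrite inE => /sA.
by rewrite cardsE; apply/card_uniqP.
Qed.

End FiniteSets.

Lemma imsetD (U V : finType) (f : U -> V) (A B : {set U}) : injective f ->
  f @: (A :\: B) = f @: A :\: f @: B.
Proof.
move=> injf; apply/setP => y; rewrite inE.
apply/imsetP/andP => [[x /setDP[xA xB] ->]|[yB /imsetP[x xA yx]]].
  by rewrite mem_imset // xB imset_f.
by exists x; rewrite // inE xA -(mem_imset _ _ injf) -yx yB.
Qed.

Lemma card_bigcup_leq (T J : finType) (A : {set J}) (B : J -> {set T}) n :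
  (forall j, #|B j| <= n) -> #|\bigcup_(j in A) B j| <= #|A| * n.
Proof.
move=> Bn; rewrite -sum_nat_const.
elim/big_rec2: _ => [|j m S _ bound]; first by rewrite cards0.
exact: leq_trans (leq_card_setU _ _) (leq_add (Bn j) bound).
Qed.

Lemma leq_sum_argmax (J : finType) (w : J -> nat) (T : {set J}) n :
  #|T| <= n -> T != set0 -> exists2 j, j \in T & \sum_(i in T) w i <= n * w j.
Proof.
move=> Tn /set0Pn[j0 j0T]; have [j jT jmax] := @arg_maxnP _ j0 (mem T) w j0T.
exists j => //; apply: (@leq_trans (#|T| * w j)); last by rewrite leq_mul2r Tn orbT.
by rewrite -sum_nat_const; apply: leq_sum => i /jmax.
Qed.

Lemma exists_injection_ord (U : finType) (n : nat) : #|U| <= n ->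
  exists g : U -> 'I_n, injective g.
Proof.
move=> Un; exists (fun a => widen_ord Un (enum_rank a)) => a c /(congr1 val) /= /val_inj.
exact: enum_rank_inj.
Qed.

Lemma bin_leq_exp n m : 'C(n, m) <= n ^ m.
Proof.
apply: (@leq_trans (n ^_ m)); first by rewrite -bin_ffact leq_pmulr ?fact_gt0.
rewrite ffact_prod -[m in n ^ m]card_ord -prod_nat_const.
by apply: leq_prod => i _; apply: leq_subr.
Qed.

(** * Client-Waiter games *)

Definition monotone (V : finType) (W : pred {set V}) :=
  forall C C' : {set V}, C \subset C' -> W C -> W C'.

Section Game.
Variables (b : nat) (V : finType).
Implicit Types (W : pred {set V}) (C D F O X : {set V}).

Definition offer F O := (O \subset F) && (0 < #|O| <= b.+1).

(* The game of [cw_client_wins] with an arbitrary winning condition on Client's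
   final set. *)
Fixpoint forces_within W n C F : bool :=
  match n with
  | 0 => W C
  | n'.+1 =>
      if F == set0 then W C
      else [forall O : {set V}, offer F O ==>
              [exists x in O, forces_within W n' (x |: C) (F :\: O)]]
  end.

Definition forces W C F := forces_within W #|F| C F.

Definition forces_on D W C F := forces W (C :&: D) (F :&: D).

Lemma card_setD_offer F O : offer F O -> #|F :\: O| < #|F|.
Proof. by case/and3P=> sOF O0 _; have := subset_leq_card sOF; rewrite cardsDS //; lia. Qed.

Lemma forces_withinE W n C F : #|F| <= n -> forces_within W n C F = forces W C F.
Proof.
suff fuel k m C' F' : #|F'| <= k -> #|F'| <= m ->
    forces_within W k C' F' = forces_within W m C' F' by move=> Fn; apply: fuel.
elim: k m C' F' => [|k IH] [|m] C' F' //=; rewrite ?leqn0 ?cards_eq0.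
- by move=> ->.
- by move=> _ ->.
move=> Fk Fm; case: eqP => // _; apply: eq_forallb => O.
apply: implyb_id2l => /card_setD_offer shrinks; apply: eq_existsb => x; congr andb.
by apply: IH; lia.
Qed.

Lemma forces0 W C : forces W C set0 = W C.
Proof. by rewrite /forces cards0. Qed.

Lemma forcesP W C F : F != set0 ->
  reflect (forall O, offer F O -> exists2 x, x \in O & forces W (x |: C) (F :\: O))
          (forces W C F).
Proof.
move=> F0; have Fp : #|F| = #|F|.-1.+1 by rewrite prednK // card_gt0.
have next O x : offer F O ->
    forces_within W #|F|.-1 (x |: C) (F :\: O) = forces W (x |: C) (F :\: O).
  by move/card_setD_offer=> shrinks; apply: forces_withinE; lia.
rewrite /forces Fp /= (negPf F0).
apply: (iffP forallP) => [play O offO|play O]; last apply/implyP => offO.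
  have /implyP/(_ offO)/exists_inP[x xO] := play O.
  by rewrite next //; exists x.
have [x xO xw] := play O offO; apply/exists_inP; exists x => //.
by rewrite next.
Qed.

Lemma forces_reply W C F O : forces W C F -> offer F O ->
  exists2 x, x \in O & forces W (x |: C) (F :\: O).
Proof.
move=> win offO; have F0 : F != set0.
  by rewrite -card_gt0; apply: leq_ltn_trans (card_setD_offer offO).
by move/(forcesP _ _ F0): win; apply.
Qed.

Lemma losing_offer W C F : F != set0 -> ~~ forces W C F ->
  exists2 O, offer F O & forall x, x \in O -> ~~ forces W (x |: C) (F :\: O).
Proof.
move=> F0 lose; suff /existsP[O /andP[offO /forall_inP loseO]] :
    [exists O, offer F O && [forall x in O, ~~ forces W (x |: C) (F :\: O)]].
  by exists O.
apply: contraNT lose => /existsPn play; apply/forcesP => // O offO.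
have := play O; rewrite offO negb_forall_in => /exists_inP[x xO].
by rewrite negbK; exists x.
Qed.

Lemma forces_invariant (P : {set V} -> {set V} -> Prop) W C F :
  (forall C, P C set0 -> W C) ->
  (forall C F O, P C F -> offer F O -> exists2 x, x \in O & P (x |: C) (F :\: O)) ->
  P C F -> forces W C F.
Proof.
move=> P_end P_round; have [n] := ubnP #|F|; elim: n C F => // n IH C F Fn PCF.
have [F0|F0] := eqVneq F set0; first by rewrite F0 forces0; apply: P_end; rewrite -F0.
apply/forcesP => // O offO; have [x xO Px] := P_round _ _ _ PCF offO.
by exists x => //; apply: IH => //; have := card_setD_offer offO; lia.
Qed.

Lemma forces_sub W W' C F : (forall C, W C -> W' C) -> forces W C F -> forces W' C F.
Proof.
move=> WW'; apply: (forces_invariant (P := forces W)); last exact: forces_reply.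
by move=> C'; rewrite forces0 => /WW'.
Qed.

Lemma forces_attainable W C F : forces W C F -> exists C', W C'.
Proof.
have [n] := ubnP #|F|; elim: n C F => // n IH C F Fn win.
have [F0|/set0Pn[y yF]] := eqVneq F set0.
  by exists C; rewrite -forces0 -F0.
have offy : offer F [set y] by rewrite /offer sub1set yF cards1.
have [x _] := forces_reply win offy.
by apply: IH; have := card_setD_offer offy; lia.
Qed.

Lemma forces_mem1 x : forces (fun C => x \in C) set0 [set x].
Proof.
have x0 : [set x] != set0 by rewrite -cards_eq0 cards1.
apply/forcesP => // O /and3P[]; rewrite subset1.
move=> /orP[/eqP-> _ _|/eqP->]; last by rewrite cards0.
by exists x; rewrite ?setDv ?forces0 /= !inE eqxx.
Qed.

Lemma forces_on_reply D W C F O :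
  forces_on D W C F -> offer F O -> O :&: D != set0 ->
  exists2 x, x \in O :&: D & forces_on D W (x |: C) (F :\: O).
Proof.
move=> win /and3P[sOF _ Ob] OD0.
have [|x xOD xw] := forces_reply (O := O :&: D) win.
  by rewrite /offer setSI // card_gt0 OD0 (leq_trans (subset_leq_card (subsetIl _ _))).
have xD : x \in D by case/setIP: xOD.
exists x => //; rewrite /forces_on setIU1_in //.
by rewrite setIDl.
Qed.

Lemma forces_on_untouched D W C F O x : x \in O -> O :&: D = set0 ->
  forces_on D W (x |: C) (F :\: O) = forces_on D W C F.
Proof.
move=> xO OD0; rewrite /forces_on setIDl OD0 setD0 setIU1_out //.
by apply/negP => xD; move/setP/(_ x): OD0; rewrite !inE xO xD.
Qed.

Lemma forces_superset W D X : monotone W -> D \subset X ->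
  forces W set0 D -> forces W set0 X.
Proof.
move=> mW DX win; apply: (forces_invariant (P := forces_on D W)).
- by move=> C; rewrite /forces_on set0I forces0; apply: mW; apply: subsetIl.
- move=> C F O winD offO; have [OD0|OD0] := eqVneq (O :&: D) set0.
    have /and3P[_ /card_gt0P[x xO] _] := offO.
    by exists x => //; rewrite forces_on_untouched.
  have [x /setIP[xO _] xw] := forces_on_reply winD offO OD0.
  by exists x.
by rewrite /forces_on set0I (setIidPr DX).
Qed.

End Game.

Lemma forces_imset (b : nat) (U V : finType) (f : U -> V) (W : pred {set V})
    (C F : {set U}) : injective f ->
  forces b W (f @: C) (f @: F) = forces b (fun X => W (f @: X)) C F.
Proof.
move=> injf; apply/idP/idP.
  apply: (@forces_invariant b U (fun C F : {set U} => forces b W (f @: C) (f @: F))).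
    by move=> X; rewrite imset0 forces0.
  move=> X Y O win /and3P[sO O0 Ob].
  have [|_ /imsetP[x xO ->] xw] := forces_reply (O := f @: O) win.
    by rewrite /offer imsetS // card_imset // O0.
  by exists x => //; rewrite imsetU1 imsetD.
move=> win; pose image_position (C' F' : {set V}) := exists (X Y : {set U}),
  [/\ C' = f @: X, F' = f @: Y & forces b (fun X => W (f @: X)) X Y].
apply: (@forces_invariant b V image_position); last by exists C, F.
  move=> C' [X [Y [-> /esym/eqP]]]; rewrite imset_eq0 => /eqP ->.
  by rewrite forces0.
move=> C' F' O [X [Y [-> -> winXY]]] /and3P[sO O0 Ob].
have preimK : f @: (f @^-1: O) = O.
  apply/setP => y; apply/imsetP/idP => [[x + ->]|yO]; first by rewrite inE.
  by have /imsetP[x _ yx] := subsetP sO y yO; exists x; rewrite // inE -yx.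
have [|x] := forces_reply (O := f @^-1: O) winXY.
  rewrite /offer -(card_imset _ injf) preimK O0 Ob !andbT; apply/subsetP => x.
  by rewrite inE => /(subsetP sO); rewrite mem_imset.
rewrite inE => fxO xw; exists (f x) => //.
by exists (x |: X), (Y :\: f @^-1: O); rewrite imsetU1 imsetD // preimK.
Qed.

(** * Playing on disjoint boards *)

Definition disjoint_family (J V : finType) (B : J -> {set V}) :=
  forall i j, i != j -> [disjoint B i & B j].

Definition winning_board (b v : nat) (V : finType) (W : pred {set V}) (B : {set V}) :=
  [/\ monotone W, #|B| <= v & forces b W set0 B].

Section Boards.
Variables (b v : nat) (V J : finType) (B : J -> {set V}) (W : J -> pred {set V}).
Hypotheses (disjB : disjoint_family B) (winB : forall j, winning_board b v (W j) (B j)).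
Implicit Types (C F O : {set V}) (T : {set J}).

Definition touched O : {set J} := [set j | O :&: B j != set0].

Lemma card_touched O : #|touched O| <= #|O|.
Proof.
rewrite /touched -sum1_card.
apply: (@leq_trans (\sum_(j : J) \sum_(x in O) (x \in B j))).
  rewrite big_mkcond /=; apply: leq_sum => j _; rewrite inE.
  by case: set0Pn => // -[x /setIP[xO xB]]; rewrite (bigD1 x) //= xB.
rewrite exchange_big -sum1_card; apply: leq_sum => x _ /=.
have [/existsP[j xj]|/existsPn none] := boolP [exists j, x \in B j]; last first.
  by rewrite big1 // => j _; rewrite (negPf (none j)).
rewrite (bigD1 j) //= big1 ?addn0 ?leq_b1 // => i ij; apply/eqP; rewrite eqb0.
by apply/negP => xi; have /disjoint_setI0/setP/(_ x) := disjB ij; rewrite !inE xi xj.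
Qed.

(* With the factor b.+1 per vertex of Client, an answer in one board makes up for
   the loss of the at most b other boards that the offer touches. *)
Definition weight C F j : nat :=
  if forces_on b (B j) (W j) C F then b.+1 ^ #|C :&: B j| else 0.

Lemma weight_leq C F j : weight C F j <= b.+1 ^ v.
Proof.
rewrite /weight; case: ifP => // _; apply: leq_pexp2l => //.
by have [_ card_B _] := winB j; apply: leq_trans (subset_leq_card (subsetIr _ _)) card_B.
Qed.

Lemma weight_start F j : B j \subset F -> weight set0 F j = 1.
Proof.
move=> BF; rewrite /weight /forces_on set0I (setIidPr BF) cards0.
by have [_ _ ->] := winB j.
Qed.

Lemma weight_end C j : 0 < weight C set0 j -> W j C.
Proof.
rewrite /weight /forces_on set0I forces0; case: ifP => // WC _.
by have [mW _ _] := winB j; apply: mW WC; apply: subsetIl.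
Qed.

Lemma weight_untouched C F O x j : x \in O -> j \notin touched O ->
  weight (x |: C) (F :\: O) j = weight C F j.
Proof.
move=> xO; rewrite inE negbK => /eqP OB; rewrite /weight forces_on_untouched //.
by rewrite setIU1_out //; apply/negP => xB; move/setP/(_ x): OB; rewrite !inE xO xB.
Qed.

Lemma weight_reply C F O j : [disjoint C & F] -> offer b F O -> j \in touched O ->
  exists2 x, x \in O :&: B j & b.+1 * weight C F j <= weight (x |: C) (F :\: O) j.
Proof.
move=> dCF offO; rewrite inE => OB.
have [winj|losej] := boolP (forces_on b (B j) (W j) C F); last first.
  by have [x xOB] := set0Pn _ OB; exists x; rewrite // {1}/weight (negPf losej) muln0.
have [x xOB xw] := forces_on_reply winj offO OB; exists x => //.
have /setIP[xO xB] := xOB; have /and3P[sOF _ _] := offO.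
rewrite /weight winj xw setIU1_in // cardsU1 inE -expnS.
by have /disjoint_setI0/setP/(_ x) := dCF; rewrite !inE (subsetP sOF) // andbT => ->.
Qed.

Lemma sum_weightD C F O T x : x \in O ->
  \sum_(j in T) weight (x |: C) (F :\: O) j =
  \sum_(j in T :&: touched O) weight (x |: C) (F :\: O) j +
  \sum_(j in T :\: touched O) weight C F j.
Proof.
move=> xO; rewrite (big_setID (touched O)) /=; congr (_ + _).
by apply: eq_bigr => j /setDP[_ jO]; apply: weight_untouched.
Qed.

Lemma weight_loss C F O T x : x \in O ->
  \sum_(j in T) weight C F j <=
  \sum_(j in T) weight (x |: C) (F :\: O) j + #|T :&: touched O| * b.+1 ^ v.
Proof.
move=> xO; rewrite (sum_weightD C F T xO) (big_setID (touched O)) /= -addnA addnC.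
rewrite [leqRHS]addnC -addnA leq_add2l; apply: leq_trans (leq_addr _ _).
by rewrite -sum_nat_const; apply: leq_sum => j _; apply: weight_leq.
Qed.

Lemma weight_gain C F O T : [disjoint C & F] -> offer b F O ->
  exists2 x, x \in O &
    \sum_(j in T) weight C F j <= \sum_(j in T) weight (x |: C) (F :\: O) j.
Proof.
move=> dCF offO; have /and3P[_ /card_gt0P[x0 x0O] Ob] := offO.
have [T0|T0] := eqVneq (T :&: touched O) set0.
  exists x0 => //; rewrite (sum_weightD C F T x0O) (big_setID (touched O)) /=.
  by rewrite T0 !big_set0.
have touched_leq : #|T :&: touched O| <= b.+1.
  apply: leq_trans (leq_trans (card_touched O) Ob).
  exact/subset_leq_card/subsetIr.
have [j jT max_j] := leq_sum_argmax (weight C F) touched_leq T0.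
have /setIP[_ jO] := jT.
have [x /setIP[xO _] gain] := weight_reply dCF offO jO; exists x => //.
rewrite (sum_weightD C F T xO) (big_setID (touched O)) /= leq_add2r.
apply: leq_trans max_j (leq_trans gain _).
by rewrite (bigD1 j) //= leq_addr.
Qed.

Section OneBoard.
Variables (W0 : pred {set V}) (D : {set V}) (T : {set J}).
Hypotheses (monoW0 : monotone W0) (winD : forces b W0 set0 D).
Hypothesis disjD : {in T, forall j, [disjoint D & B j]}.

(* Client answers in D whenever D is touched and in the heaviest touched board
   otherwise; only the at most #|F :&: D| answers in D lose boards, at most b each. *)
Definition one_board_position C F :=
  [/\ [disjoint C & F], forces_on b D W0 C F &
      b * b.+1 ^ v * #|F :&: D| < \sum_(j in T) weight C F j].

Lemma reply_in_D C F O : one_board_position C F -> offer b F O -> O :&: D != set0 ->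
  exists2 x, x \in O & one_board_position (x |: C) (F :\: O).
Proof.
move=> [dCF win sumw] offO OD.
have [x /setIP[xO xD] xw] := forces_on_reply win offO OD.
exists x => //; split=> //; first exact: disjointU1D.
have /and3P[sOF _ Ob] := offO.
have touched_leq : #|T :&: touched O| <= b.
  rewrite -ltnS; apply: leq_trans Ob; rewrite [in leqRHS](cardsD1 x) xO ltnS.
  apply: leq_trans (card_touched (O :\ x)); apply: subset_leq_card.
  apply/subsetP => j /setIP[jT]; rewrite !inE => /set0Pn[y /setIP[yO yB]].
  apply/set0Pn; exists y; rewrite !inE yO yB !andbT; apply: contraTneq yB => ->.
  by have /disjoint_setI0/setP/(_ x) := disjD jT; rewrite !inE xD /= => ->.
have Dlt : #|(F :\: O) :&: D| < #|F :&: D|.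
  rewrite setIDl; apply: (@card_setD_offer b); rewrite /offer setSI // card_gt0 OD.
  exact: leq_trans (subset_leq_card (subsetIl _ _)) Ob.
have := weight_loss C F T xO.
have : #|T :&: touched O| * b.+1 ^ v <= b * b.+1 ^ v by rewrite leq_mul2r touched_leq orbT.
have : b * b.+1 ^ v * #|(F :\: O) :&: D|.+1 <= b * b.+1 ^ v * #|F :&: D|.
  by rewrite leq_mul2l Dlt orbT.
by rewrite mulnS; lia.
Qed.

Lemma reply_outside_D C F O : one_board_position C F -> offer b F O -> O :&: D = set0 ->
  exists2 x, x \in O & one_board_position (x |: C) (F :\: O).
Proof.
move=> [dCF win sumw] offO OD; have [x xO gain] := weight_gain T dCF offO.
exists x => //; split; [exact: disjointU1D | by rewrite forces_on_untouched |].
by rewrite setIDl OD setD0; apply: leq_trans sumw gain.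
Qed.

Lemma forces_one_board : b * b.+1 ^ v * #|D| < #|T| ->
  forces b (fun C => W0 C && [exists j in T, W j C]) set0 (D :|: \bigcup_(j in T) B j).
Proof.
move=> many; apply: (@forces_invariant b V one_board_position).
- move=> C [_]; rewrite /forces_on set0I forces0 cards0 muln0 => W0C sumw.
  rewrite (monoW0 (subsetIl C D)) //=; apply: contraTT sumw => /exists_inPn none.
  rewrite big1 // => j /none; apply: contraNeq; rewrite -lt0n; exact: weight_end.
- move=> C F O pos offO; have [OD|OD] := eqVneq (O :&: D) set0.
    exact: reply_outside_D.
  exact: reply_in_D.
split; first by rewrite disjoints_subset sub0set.
  by rewrite /forces_on set0I (setIidPr (subsetUl _ _)).
rewrite (setIidPr (subsetUl _ _)) (eq_bigr (fun=> 1)) ?sum1_card // => j jT.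
by rewrite weight_start // subsetU // bigcup_sup ?orbT.
Qed.

End OneBoard.
End Boards.

(* The boards used for the first types are added to D, whose size stays bounded, so
   that boundedly many boards of the next type suffice. *)
Lemma forces_board_of_each_type_seq (b v : nat) (K : eqType) (ks : seq K) (d : nat) :
  uniq ks -> exists M, forall (V J : finType) (type : J -> K) (B : J -> {set V})
    (W : J -> pred {set V}) (W0 : pred {set V}) (D : {set V}),
  disjoint_family B -> (forall j, winning_board b v (W j) (B j)) ->
  {in ks, forall k, M <= #|[set j | type j == k]|} ->
  monotone W0 -> forces b W0 set0 D -> #|D| <= d ->
  (forall j, type j \in ks -> [disjoint D & B j]) ->
  forces b (fun C => W0 C && all (fun k => [exists (j | type j == k), W j C]) ks)
    set0 setT.
Proof.
elim: ks d => [|k ks IH] d /=.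
  move=> _; exists 0 => V J type B W W0 D _ _ _ mW0 winD _ _.
  by apply: forces_sub (forces_superset mW0 (subsetT D) winD) => C ->.
move=> /andP[kks uks]; pose quota := (b * b.+1 ^ v * d).+1.
have [M win_rest] := IH (d + quota * v) uks; exists (maxn quota M).
move=> V J type B W W0 D disjB winB many mW0 winD Dd disjD.
have [T Tk cardT] : exists2 T : {set J}, T \subset [set j | type j == k] & #|T| = quota.
  by apply: exists_subset_card; apply: leq_trans (leq_maxl _ _) (many k (mem_head _ _)).
have typeT j : j \in T -> type j = k by move/(subsetP Tk); rewrite inE => /eqP.
have disjT : {in T, forall j, [disjoint D & B j]}.
  by move=> j /typeT jk; apply: disjD; rewrite jk mem_head.
have winD' := forces_one_board disjB winB mW0 winD disjT.
rewrite cardT ltnS leq_mul2l Dd orbT in winD'.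
apply: forces_sub (win_rest V J type B W _ _ disjB winB _ _ (winD' isT) _ _) => [C|l lks|||].
- case/andP=> /andP[-> /existsP[j /andP[/typeT jk Wj]]] -> /=; rewrite andbT.
  by apply/existsP; exists j; rewrite jk eqxx.
- by apply: leq_trans (leq_maxr quota M) (many l _); rewrite inE lks orbT.
- move=> C C' CC' /andP[/(mW0 _ _ CC') -> /existsP[j /andP[jT Wj]]].
  apply/existsP; exists j; rewrite jT.
  by have [mWj _ _] := winB j; apply: mWj Wj.
- apply: leq_trans (leq_card_setU _ _) (leq_add Dd _); rewrite -cardT.
  by apply: card_bigcup_leq => j; have [] := winB j.
move=> j jks; rewrite -setI_eq0 setIUl setU_eq0 !setI_eq0 disjD ?inE ?jks ?orbT //=.
rewrite disjoint_sym; apply: bigcup_disjoint => i /typeT ik; apply: disjB.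
by apply: contraNneq kks => ji; rewrite -ik -ji.
Qed.

Lemma forces_board_of_each_type (b v d : nat) (K : finType) :
  exists M, forall (V : finType) (B : K * 'I_M -> {set V})
    (W : K * 'I_M -> pred {set V}) (W0 : pred {set V}) (D : {set V}),
  disjoint_family B -> (forall j, winning_board b v (W j) (B j)) ->
  monotone W0 -> forces b W0 set0 D -> #|D| <= d -> (forall j, [disjoint D & B j]) ->
  forces b (fun C => W0 C && [forall k, [exists i, W (k, i) C]]) set0 setT.
Proof.
have [M win_each] := forces_board_of_each_type_seq b v d (enum_uniq K); exists M.
move=> V B W W0 D disjB winB mW0 winD Dd disjD.
apply: forces_sub (win_each V _ fst B W W0 D disjB winB _ mW0 winD Dd (fun j _ => disjD j)).
  move=> C /andP[-> /allP each]; apply/forallP => k.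
  have /existsP[[l i] /andP[/eqP <- Wli]] := each k (mem_enum _ k).
  by apply/existsP; exists i.
move=> k _; have pair_inj : injective (pair k : 'I_M -> K * 'I_M) by move=> ? ? [].
rewrite -[M in M <= _]card_ord -(card_imset _ pair_inj); apply: subset_leq_card.
by apply/subsetP => _ /imsetP[i _ ->]; rewrite inE.
Qed.

(* Waiter plays on the classes of r one after the other. *)
Lemma waiter_wins_classwise (b : nat) (V K : finType) (r : V -> K) (W : pred {set V}) C F :
  (forall C, W C -> exists k, W (C :&: r @^-1: [set k])) ->
  (forall k, ~~ forces_on b (r @^-1: [set k]) W C F) -> ~~ forces b W C F.
Proof.
move=> localW; have [n] := ubnP #|F|; elim: n C F => // n IH C F Fn lose.
have [F0|/set0Pn[y yF]] := eqVneq F set0.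
  rewrite F0 forces0; apply/negP => /localW[k]; apply/negP.
  by have := lose k; rewrite /forces_on F0 set0I forces0.
pose D := r @^-1: [set r y].
have FD0 : F :&: D != set0 by apply/set0Pn; exists y; rewrite !inE yF eqxx.
have [O /and3P[sO O0 Ob] loseO] := losing_offer FD0 (lose (r y)).
have [sOF sOD] : O \subset F /\ O \subset D by apply/andP; rewrite -subsetI.
have offO : offer b F O by rewrite /offer sOF O0.
apply/negP => /forces_reply/(_ offO)[x xO]; apply/negP; apply: IH => [|k].
  by have := card_setD_offer offO; lia.
have [->|kr] := eqVneq k (r y).
  rewrite /forces_on setIDl setIU1_in ?(subsetP sOD) // (setIidPl sOD).
  exact: loseO.
rewrite forces_on_untouched //; apply/setP => z; rewrite !inE.
apply/negP => /andP[/(subsetP sOD)]; rewrite !inE => /eqP zy /eqP zk.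
by rewrite -zk zy eqxx in kr.
Qed.

(** * Connected sets, forests and darts *)

Section Connectivity.
Variables (V : finType) (e : rel V).
Implicit Types (S : {set V}) (x y z : V).

Inductive connected_set : {set V} -> Prop :=
| connected_set1 x : connected_set [set x]
| connected_setU1 S x y of connected_set S & x \notin S & y \in S & e x y :
    connected_set (x |: S).

Definition restrict S : rel V := [rel x y in S | e x y].

Lemma connected_set_neq0 S : connected_set S -> exists x, x \in S.
Proof. by case=> [x|S' x y _ _ _ _]; exists x; rewrite !inE eqxx. Qed.

Lemma path_restrict S x p : path (restrict S) x p -> path e x p /\ {subset p <= S}.
Proof.
elim: p x => //= y p IH x /andP[/andP[/andP[_ yS] ->] /IH[-> pS]]; split=> // z.
by rewrite inE => /orP[/eqP->|/pS].
Qed.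

Lemma connect_boundary_edge S x y : connect e x y -> x \in S -> y \notin S ->
  exists a c, [/\ a \in S, c \notin S & e a c].
Proof.
move=> /connectP[p pp ->]; elim: p x pp => [|c p IH] x /=; first by move=> _ ->.
move=> /andP[exc pp] xS; have [cS|cS] := boolP (c \in S); first exact: IH.
by move=> _; exists x, c.
Qed.

Lemma component_closed x y z : y \in component e x -> e y z -> z \in component e x.
Proof. by rewrite !inE => xy /connect1; apply: connect_trans. Qed.

Section Simple.
Hypothesis simple_e : simple_graph e.

Lemma simple_connect_sym : connect_sym e.
Proof. by apply: sym_connect_sym; case: simple_e. Qed.

Lemma component_gt1 x y : e x y -> 1 < #|component e x|.
Proof.
have [_ irr_e] := simple_e; move=> exy.
have xy : x != y by apply: contraTneq exy => ->; rewrite irr_e.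
apply: leq_trans (subset_leq_card (_ : [set x; y] \subset _)); first by rewrite cards2 xy.
by rewrite subUset !sub1set !inE connect0 connect1.
Qed.

Lemma connected_set_connect S : connected_set S ->
  {in S &, forall x y, connect (restrict S) x y}.
Proof.
have [sym_e _] := simple_e; have sym_restrict S' : connect_sym (restrict S').
  by apply: sym_connect_sym => x y; rewrite /restrict /= sym_e [_ && (y \in _)]andbC.
elim=> [x a c|S' x y _ IH _ yS exy]; first by rewrite !inE => /eqP-> /eqP->.
have restrict_sub : subrel (connect (restrict S')) (connect (restrict (x |: S'))).
  apply: connect_sub => a c /= /andP[/andP[aS cS] eac]; apply: connect1.
  by rewrite /restrict /= !inE aS cS !orbT.
have x_connect c : c \in S' -> connect (restrict (x |: S')) x c.
  move=> cS; apply: connect_trans (restrict_sub _ _ (IH y c yS cS)).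
  by apply: connect1; rewrite /restrict /= !inE eqxx yS exy orbT.
move=> a c; rewrite !inE => /orP[/eqP->|aS] /orP[/eqP->|cS] //.
- exact: x_connect.
- by rewrite sym_restrict; apply: x_connect.
- exact/restrict_sub/IH.
Qed.

Lemma connected_subset_component x n : 0 < n <= #|component e x| ->
  exists S, [/\ connected_set S, S \subset component e x & #|S| = n].
Proof.
have [sym_e _] := simple_e; elim: n => // -[_ _|n IH].
  exists [set x]; split; [exact: connected_set1 | | by rewrite cards1].
  by rewrite sub1set inE.
move=> /= n_lt; have [|S [conS sS cardS]] := IH; first by rewrite /= ltnW.
have [z zx zS] : exists2 z, z \in component e x & z \notin S.
  by apply/subsetPn; apply: contraTN n_lt => /subset_leq_card; rewrite cardS -leqNgt.
have [y yS] := connected_set_neq0 conS.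
have yz : connect e y z.
  move: zx (subsetP sS y yS); rewrite !inE => xz xy.
  by apply: connect_trans xz; rewrite simple_connect_sym.
have [a [c [aS cS eac]]] := connect_boundary_edge yz yS zS.
exists (c |: S); split; last by rewrite cardsU1 cS cardS.
  by apply: connected_setU1 conS cS aS _; rewrite sym_e.
by rewrite subUset sub1set (component_closed (subsetP sS a aS) eac).
Qed.

Lemma component_connected_set x : connected_set (component e x).
Proof.
have [|S [conS sS cardS]] := @connected_subset_component x #|component e x|.
  by rewrite leqnn andbT; apply/card_gt0P; exists x; rewrite inE.
by have /eqP <- : S == component e x by rewrite eqEcard sS cardS leqnn.
Qed.

End Simple.

Lemma forest_unique_neighbor S x y z : is_forest e -> connected_set S ->
  x \notin S -> y \in S -> z \in S -> e x y -> e x z -> y = z.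
Proof.
move=> [simple_e acyclic] conS xS yS zS exy exz; apply/eqP; apply/negP => /negP yz.
have /connectP[p0 pp0 lp0] := connected_set_connect simple_e conS yS zS.
case/shortenP: pp0 lp0 => p pp up _ lp; have [pe pS] := path_restrict pp.
apply: acyclic; exists (x :: y :: p); split.
- rewrite cons_uniq up andbT; apply: contraNN xS; rewrite inE => /orP[/eqP->//|].
  exact: pS.
- by case: p {pp up pe pS} lp => //= lp; rewrite lp eqxx in yz.
by rewrite /= exy rcons_path pe -lp /=; case: simple_e => ->.
Qed.

Lemma cycle_two_neighbors (s : seq V) x :
  cycle e s -> uniq s -> 3 <= size s -> x \in s ->
  exists y z, [/\ y \in s, z \in s, y != z, e x y & e z x].
Proof.
move=> cs us ss /rot_to[i s' rot_s].
have mem_s y : (y \in s) = (y \in x :: s') by rewrite -rot_s mem_rot.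
move: cs us ss; rewrite -(rot_cycle i) -(rot_uniq i) -(size_rot i) rot_s.
case: s' rot_s mem_s => [|y [|c t]] // rot_s mem_s.
rewrite /= rcons_path => /and3P[exy eyc /andP[_ ez]] /and4P[_ yN _ _] _.
exists y, (last c t); split=> //.
- by rewrite mem_s !inE eqxx orbT.
- by rewrite mem_s inE [_ \in y :: _]inE mem_last !orbT.
- by apply: contraNneq yN => ->; apply: mem_last.
Qed.

End Connectivity.

Lemma tree_connected_set (V : finType) (e : rel V) : is_tree e -> connected_set e setT.
Proof.
move=> [[simple_e _] [/card_gt0P[x _] conn]].
suff <- : component e x = setT by apply: component_connected_set.
by apply/setP => y; rewrite !inE conn.
Qed.

(* [ndarts e S] is twice the number of edges inside S. *)
Definition ndarts (V : finType) (e : rel V) (S : {set V}) : nat :=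
  \sum_(x in S) \sum_(y in S) e x y.

Lemma ndarts0 (V : finType) (e : rel V) : ndarts e set0 = 0.
Proof. by rewrite /ndarts big_set0. Qed.

Lemma ndarts_imset (U V : finType) (eU : rel U) (eV : rel V) (f : U -> V) (A : {set U}) :
  injective f -> {mono f : a c / eU a c >-> eV a c} ->
  ndarts eV (f @: A) = ndarts eU A.
Proof.
move=> injf eVf; have injA : {in A &, injective f} by move=> ? ? _ _ /injf.
rewrite /ndarts big_imset //=; apply: eq_bigr => a _.
by rewrite big_imset //=; apply: eq_bigr => c _; rewrite eVf.
Qed.

Section Darts.
Variables (V : finType) (e : rel V).
Hypothesis simple_e : simple_graph e.
Implicit Types (S A : {set V}) (x y : V).

Lemma ndarts1 x : ndarts e [set x] = 0.
Proof. by rewrite /ndarts !big_set1; case: simple_e => _ ->. Qed.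

Lemma ndartsU1 S x : x \notin S ->
  ndarts e (x |: S) = ndarts e S + 2 * \sum_(y in S) e x y.
Proof.
have [sym_e irr_e] := simple_e; move=> xS.
rewrite /ndarts big_setU1 //= big_setU1 //= irr_e add0n.
have -> : \sum_(a in S) \sum_(y in x |: S) e a y =
    \sum_(a in S) (e x a + \sum_(y in S) e a y).
  by apply: eq_bigr => a aS; rewrite big_setU1 //= sym_e.
by rewrite big_split /=; lia.
Qed.

Lemma connected_set_ndarts S : connected_set e S -> 2 * #|S| <= ndarts e S + 2.
Proof.
elim=> [x|S' x y _ IH xS yS exy]; first by rewrite cards1 leq_addl.
by rewrite ndartsU1 // cardsU1 xS (bigD1 y) //= exy; lia.
Qed.

Lemma has_cycle_ndarts : has_cycle e -> exists2 S, S != set0 & 2 * #|S| <= ndarts e S.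
Proof.
have [sym_e _] := simple_e; move=> [s [us ss cs]]; exists [set x in s].
  rewrite -card_gt0 cardsE; have /card_uniqP -> := us; exact: leq_trans ss.
rewrite mulnC -sum_nat_const; apply: leq_sum => x; rewrite inE => xs.
have [y [z [ys zs yz exy ezx]]] := cycle_two_neighbors cs us ss xs.
by rewrite (bigD1 y) ?inE //= (bigD1 z) ?inE ?zs 1?eq_sym //= exy sym_e ezx.
Qed.

End Darts.

Lemma forest_ndarts (V : finType) (e : rel V) (S A : {set V}) :
  is_forest e -> connected_set e S ->
  A \subset S -> A != set0 -> ndarts e A + 2 <= 2 * #|A|.
Proof.
move=> forest_e; have [simple_e _] := forest_e.
move=> conS; elim: conS A => [x|S' x y conS IH xS yS exy] A.
  by rewrite subset1 => /orP[/eqP->|->//]; rewrite ndarts1 ?cards1.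
move=> AS A0; have AS' : A :\ x \subset S' by rewrite subDset.
have [xA|xA] := boolP (x \in A); last first.
  have /setDidPl Ax : [disjoint A & [set x]] by rewrite disjoint_sym disjoints1.
  by apply: IH => //; rewrite -Ax.
have xAx : x \notin A :\ x by rewrite !inE eqxx.
rewrite -(setD1K xA) ndartsU1 // cardsU1 xAx.
have [->|Ax0] := eqVneq (A :\ x) set0; first by rewrite ndarts0 big_set0 cards0.
suff : \sum_(c in A :\ x) e x c <= 1 by have := IH _ AS' Ax0; lia.
have unique c : c \in A :\ x -> e x c -> c = y.
  move=> cA exc.
  exact: (forest_unique_neighbor forest_e conS xS (subsetP AS' _ cA) yS exc exy).
have [yA|yA] := boolP (y \in A :\ x).
  rewrite (bigD1 y) //= big1 ?addn0 ?leq_b1 // => c /andP[cA cy].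
  by apply/eqP; rewrite eqb0; apply: contraNN cy => /(unique c cA) ->.
by rewrite big1 // => c cA; apply/eqP; rewrite eqb0; apply: contraNN yA => /(unique c cA) <-.
Qed.

Lemma tree_ndarts (V : finType) (e : rel V) (A : {set V}) :
  is_tree e -> A != set0 -> ndarts e A + 2 <= 2 * #|A|.
Proof.
move=> tree_e; have [forest_e _] := tree_e.
exact: forest_ndarts forest_e (tree_connected_set tree_e) (subsetT A).
Qed.

Lemma nedges_tree (V : finType) (e : rel V) : is_tree e -> #|V| = (nedges e).+1.
Proof.
move=> tree_e; have [[simple_e _] [V0 _]] := tree_e.
have -> : nedges e = ndarts e setT %/ 2.
  rewrite /nedges -sum1_card /ndarts pair_big /= big_mkcond [in RHS]big_mkcond /=.
  by congr (_ %/ _); apply: eq_bigr => p _; rewrite !inE; case: (e _ _).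
have edges_ge := connected_set_ndarts simple_e (tree_connected_set tree_e).
have edges_le : ndarts e setT + 2 <= 2 * #|[set: V]|.
  by apply: tree_ndarts; rewrite // -card_gt0 cardsT.
by rewrite cardsT in edges_ge edges_le; lia.
Qed.

(** * Copies and winning trees *)

Definition embedding (VH : finType) (eH : rel VH) (A : {set VH}) (VG : finType)
    (eG : rel VG) (C : {set VG}) (f : VH -> VG) :=
  [/\ {in A, forall x, f x \in C}, {in A &, injective f} &
      {in A &, {homo f : x y / eH x y >-> eG x y}}].

Section Copies.
Variables (b : nat) (VH : finType) (eH : rel VH).
Implicit Types (A : {set VH}).

Lemma has_copyP A (VG : finType) (eG : rel VG) (C : {set VG}) :
  reflect (exists f, embedding eH A eG C f) (has_copy eH A eG C).
Proof.
apply: (iffP existsP) => [[f /andP[/forall_inP fC /forall_inP fA]]|[f [fC injf homf]]].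
  exists f; split=> // x y xA yA; have /forall_inP /(_ y yA) /andP[] := fA x xA.
    by move=> /implyP inj _ fxy; apply/eqP/inj; rewrite fxy.
  by move=> _ /implyP.
exists (finfun f); apply/andP; split; first by apply/forall_inP => x /fC; rewrite ffunE.
apply/forall_inP => x xA; apply/forall_inP => y yA; rewrite !ffunE.
apply/andP; split; apply/implyP; last exact: homf.
by move=> /eqP /injf ->.
Qed.

Lemma has_copy_monotone A (VG : finType) (eG : rel VG) : monotone (has_copy eH A eG).
Proof.
move=> C C' CC' /has_copyP[f [fC injf homf]]; apply/has_copyP; exists f; split=> //.
by move=> x /fC /(subsetP CC').
Qed.

Lemma has_copy_subset A A' (VG : finType) (eG : rel VG) (C : {set VG}) :
  A \subset A' -> has_copy eH A' eG C -> has_copy eH A eG C.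
Proof.
move=> /subsetP AA' /has_copyP[f [fC injf homf]]; apply/has_copyP; exists f.
by split=> [x /AA' /fC //|x y /AA' xA /AA' yA|x y /AA' xA /AA' yA]; [apply: injf|apply: homf].
Qed.

Lemma has_copy_imset A (VG VG' : finType) (eG : rel VG) (eG' : rel VG') (f : VG -> VG')
    (C : {set VG}) :
  injective f -> {homo f : x y / eG x y >-> eG' x y} ->
  has_copy eH A eG C -> has_copy eH A eG' (f @: C).
Proof.
move=> injf homf /has_copyP[g [gC injg homg]]; apply/has_copyP; exists (f \o g).
split=> [x /gC gx|x y xA yA /injf /injg -> //|x y xA yA /homg exy].
  exact: imset_f.
by apply: homf; apply: exy.
Qed.

Lemma has_copy_relpre A (VG VG' : finType) (eG' : rel VG') (f : VG -> VG') (C : {set VG})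
    (x0 : VG) :
  injective f -> has_copy eH A eG' (f @: C) -> has_copy eH A (relpre f eG') C.
Proof.
move=> injf /has_copyP[h [hC injh homh]].
pose g x := odflt x0 [pick z | h x == f z].
have fg x : x \in A -> f (g x) = h x.
  move=> /hC /imsetP[z _ hz]; rewrite /g; case: pickP => [z' /eqP //|/(_ z)].
  by rewrite hz eqxx.
apply/has_copyP; exists g; split=> [x xA|x y xA yA gxy|x y xA yA exy].
- by rewrite -(mem_imset _ _ injf) fg // hC.
- by apply: injh; rewrite -?fg ?gxy.
- by rewrite /= !fg //; apply: homh.
Qed.

Lemma has_copy_components (VG : finType) (eG : rel VG) (C : {set VG}) (D : VH -> {set VG}) :
  simple_graph eH -> disjoint_family D ->
  (forall x, has_copy eH (component eH x) eG (C :&: D x)) -> has_copy eH setT eG C.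
Proof.
move=> simple_H disjD copies; have symH := simple_connect_sym simple_H.
have /fin_all_exists[g embg] x := has_copyP _ _ _ (copies x).
pose rt := fingraph.root eH.
have rtP z : z \in component eH (rt z) by rewrite inE symH connect_root.
apply/has_copyP; exists (fun z => g (rt z) z); split=> [z _|z w _ _ eq_g|z w _ _ ezw].
- by have [gC _ _] := embg (rt z); have /setIP[] := gC z (rtP z).
- have [rzw|rzw] := eqVneq (rt z) (rt w).
    have [_ inj _] := embg (rt w); have zw := rtP z.
    by rewrite rzw in eq_g zw; apply: inj zw (rtP w) eq_g.
  have [gz _ _] := embg (rt z); have [gw _ _] := embg (rt w).
  have /setIP[_ zD] := gz z (rtP z); have /setIP[_ wD] := gw w (rtP w).
  by have /disjoint_setI0/setP/(_ (g (rt w) w)) := disjD _ _ rzw; rewrite !inE wD -eq_g zD.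
have rzw : rt z = rt w by apply/eqP; rewrite /rt root_connect // connect1.
have [_ _ hom] := embg (rt w); have zw := rtP z.
by rewrite rzw in zw *; apply: hom zw (rtP w) ezw.
Qed.

Lemma client_winsE A (VG : finType) (eG : rel VG) :
  client_wins b eH A eG = forces b (has_copy eH A eG) set0 setT.
Proof.
have cwE n C F : cw_client_wins b eH A eG n C F = forces_within b (has_copy eH A eG) n C F.
  elim: n C F => //= n IH C F; case: ifP => // _; apply: eq_forallb => O.
  by congr (_ ==> _); apply: eq_existsb => x; rewrite IH.
by rewrite /client_wins /forces cwE cardsT.
Qed.

Lemma client_wins_card A (VG : finType) (eG : rel VG) : client_wins b eH A eG -> #|A| <= #|VG|.
Proof.
rewrite client_winsE => /forces_attainable[C /has_copyP[f [_ injf _]]].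
by rewrite -(card_in_imset injf) max_card.
Qed.

Lemma winning_board_image A (VT VG : finType) (eT : rel VT) (eG : rel VG) (f : VT -> VG) :
  injective f -> {homo f : x y / eT x y >-> eG x y} -> client_wins b eH A eT ->
  winning_board b #|VT| (fun C => has_copy eH A eG (C :&: f @: setT)) (f @: setT).
Proof.
move=> injf homf; rewrite client_winsE => winT; split.
- by move=> C C' CC'; apply: has_copy_monotone; apply: setSI.
- by rewrite card_imset // cardsT.
rewrite -(imset0 f) forces_imset //; apply: forces_sub winT => C copyC.
by rewrite (setIidPl (imsetS _ (subsetT _))); apply: has_copy_imset copyC.
Qed.

End Copies.

(* A vertex of V outside the image of f has at most one neighbor, so it lies on no cycle. *)
Lemma has_cycle_preim (U V : finType) (eU : rel U) (eV : rel V) (f : U -> V) :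
  injective f -> (forall a c, eV (f a) (f c) -> eU a c) ->
  (forall x y z, eV x y -> eV z x -> y != z -> x \in codom f) ->
  has_cycle eV -> has_cycle eU.
Proof.
move=> injf reflects core [s [us ss cs]].
have /subset_mapP[t _ s_map] : {subset s <= codom f}.
  move=> x xs; have [y [z [_ _ yz exy ezx]]] := cycle_two_neighbors cs us ss xs.
  exact: core exy ezx yz.
exists t; move: us ss cs; rewrite s_map size_map map_inj_uniq // cycle_map => ut st ct.
by split=> //; apply: sub_cycle ct => a c; apply: reflects.
Qed.

Section AddLeaves.
Variables (V L : finType) (e : rel V) (anchor : L -> V).

Definition add_leaves : rel (V + L) :=
  fun u w => match u, w with
             | inl a, inl c => e a c
             | inl a, inr l | inr l, inl a => a == anchor l
             | inr _, inr _ => false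
             end.

Lemma add_leaves_tree : is_tree e -> is_tree add_leaves.
Proof.
move=> [[[sym_e irr_e] acyclic] [V0 conn]].
have sym_l : symmetric add_leaves by case=> [a|a] [c|c] /=.
split; first split.
- by split=> // -[a|l] /=.
- apply: contra_not acyclic; apply: (has_cycle_preim (f := inl)) => //.
    by move=> ? ? [].
  case=> [a|l] y z; first by rewrite codom_f.
  by case: y z => [y|?] [z|?] //= /eqP-> /eqP->; rewrite eqxx.
split; first by rewrite card_sum ltn_addr.
have to_core u : exists a, connect add_leaves u (inl a).
  by case: u => [a|l]; [exists a | exists (anchor l); apply: connect1 => /=].
have core a c : connect add_leaves (inl a) (inl c).
  have /connectP[p pp ->] := conn a c.
  by apply/connectP; exists (map inl p); rewrite ?last_map // path_map.
move=> u w; have [a ua] := to_core u; have [c wc] := to_core w.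
apply: connect_trans ua (connect_trans (core a c) _).
by rewrite (sym_connect_sym sym_l).
Qed.

Lemma has_copy_add_leaf (VH : finType) (eH : rel VH) (S : {set VH}) x y (C : {set V + L}) :
  is_forest eH -> connected_set eH S -> x \notin S -> y \in S -> eH x y ->
  has_copy eH S add_leaves (C :&: inl @: setT) ->
  (forall a, exists2 l, anchor l = a & inr l \in C) ->
  has_copy eH (x |: S) add_leaves C.
Proof.
move=> forestH conS xS yS exy /has_copyP[f [fC injf homf]] leaf.
have [[sym_H irr_H] _] := forestH.
have f_core z : z \in S -> f z \in C /\ exists a, f z = inl a.
  by move=> /fC /setIP[fzC /imsetP[a _ fza]]; split=> //; exists a.
have [_ [a fya]] := f_core y yS; have [l anchor_l lC] := leaf a.
pose g z := if z == x then inr l else f z.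
have gx : g x = inr l by rewrite /g eqxx.
have gS z : z \in S -> g z = f z by rewrite /g; case: eqP xS => // -> /negPf->.
have g_neq z : z \in S -> g z <> inr l.
  by move=> zS; rewrite gS //; have [_ [c ->]] := f_core z zS.
have neighbor z : z \in S -> eH x z -> z = y.
  by move=> zS exz; apply: (forest_unique_neighbor forestH conS xS zS yS exz exy).
apply/has_copyP; exists g; split.
- move=> z; rewrite !inE => /orP[/eqP->|zS]; first by rewrite gx.
  by rewrite gS //; case: (f_core z zS).
- move=> z w; rewrite !inE => /orP[/eqP->|zS] /orP[/eqP->|wS] //.
  + by rewrite gx => /esym/(g_neq _ wS).
  + by rewrite gx => /(g_neq _ zS).
  + by rewrite !gS //; apply: injf.
- move=> z w; rewrite !inE => /orP[/eqP->|zS] /orP[/eqP->|wS].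
  + by rewrite irr_H.
  + by move=> /(neighbor _ wS) ->; rewrite gx gS // fya /= anchor_l.
  + by rewrite sym_H => /(neighbor _ zS) ->; rewrite gx gS // fya /= anchor_l.
  + by rewrite !gS //; apply: homf.
Qed.

End AddLeaves.

Lemma client_wins_set1 (b : nat) (VH : finType) (eH : rel VH) (x : VH) :
  simple_graph eH ->
  exists (VT : finType) (eT : rel VT), is_tree eT /\ client_wins b eH [set x] eT.
Proof.
move=> [_ irr_H]; exists unit, (fun _ _ => false); split.
  split; last by split; [rewrite card_unit | case=> -[]].
  by split=> [|[[|u [|w s]] [_]]].
have unitT : [set: unit] = [set tt] by apply/setP => -[]; rewrite !inE.
rewrite client_winsE unitT; apply: forces_sub (forces_mem1 b tt) => C ttC.
apply/has_copyP; exists (fun=> tt).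
by split=> // [z w|z w]; rewrite !inE => /eqP -> /eqP -> //; rewrite irr_H.
Qed.

Lemma client_wins_add_leaf (b : nat) (VH : finType) (eH : rel VH) (S : {set VH}) x y
    (VT : finType) (eT : rel VT) :
  is_forest eH -> connected_set eH S -> x \notin S -> y \in S -> eH x y ->
  client_wins b eH S eT ->
  exists M, client_wins b eH (x |: S) (add_leaves eT (fst : VT * 'I_M -> VT)).
Proof.
move=> forestH conS xS yS exy winT.
have [M win_each] := forces_board_of_each_type b 1 #|VT| VT; exists M.
pose leaf (l : VT * 'I_M) : VT + VT * 'I_M := inr l.
pose eL := add_leaves eT (fst : VT * 'I_M -> VT).
have inl_inj : injective (inl : VT -> VT + VT * 'I_M) by move=> ? ? [].
have [mono_core card_core win_core] :=
  winning_board_image (eG := eL) inl_inj (fun _ _ => id) winT.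
rewrite client_winsE.
apply: forces_sub (win_each _ (fun l => [set leaf l]) (fun l C => leaf l \in C) _ _ _ _
  mono_core win_core card_core _).
- move=> C /andP[copyS /forallP leaves].
  apply: (has_copy_add_leaf forestH conS xS yS exy copyS) => a.
  by have /existsP[i iC] := leaves a; exists (a, i).
- by move=> i j ij; rewrite disjoints1 inE; apply: contraNneq ij => -[->].
- move=> l; split; [by move=> C C' /subsetP CC' /CC' | by rewrite cards1 |].
  exact: forces_mem1.
by move=> l; rewrite disjoint_sym disjoints1; apply/imsetP => -[].
Qed.

Lemma connected_set_winning_tree (b : nat) (VH : finType) (eH : rel VH) (A : {set VH}) :
  is_forest eH -> connected_set eH A ->
  exists (VT : finType) (eT : rel VT), is_tree eT /\ client_wins b eH A eT.
Proof.
move=> forestH; elim=> [x|S x y conS [VT [eT [treeT winT]]] xS yS exy].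
  by apply: client_wins_set1; case: forestH.
have [M winM] := client_wins_add_leaf forestH conS xS yS exy winT.
by exists (VT + VT * 'I_M)%type, (add_leaves eT fst); split; first exact: add_leaves_tree.
Qed.

Lemma min_winning_tree_exists (b : nat) (VH : finType) (eH : rel VH) (A : {set VH}) :
  is_forest eH -> connected_set eH A ->
  exists (VT : finType) (eT : rel VT), min_winning_tree b eH A eT.
Proof.
move=> forestH /(connected_set_winning_tree b forestH)[VT [eT [treeT winT]]].
have [n] := ubnP #|VT|; elim: n VT eT treeT winT => // n IH VT eT treeT winT Tn.
have [[VT' [eT' [treeT' winT' smaller]]]|minimal] :=
  classic (exists (VT' : finType) (eT' : rel VT'),
    [/\ is_tree eT', client_wins b eH A eT' & #|VT'| < #|VT|]).
  by apply: IH treeT' winT' _; apply: leq_trans smaller _.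
exists VT, eT; split=> // VT' eT' treeT' winT'; rewrite leqNgt; apply/negP => smaller.
by apply: minimal; exists VT', eT'.
Qed.

(** * Waiter's win on sparse graphs *)

Definition winning_trees_exceed (b : nat) (VH : finType) (eH : rel VH) (A : {set VH}) (m : nat) :=
  forall (VT : finType) (eT : rel VT), is_tree eT -> client_wins b eH A eT -> m < #|VT|.

Definition induced (V : finType) (e : rel V) (S : {set V}) : rel {x | x \in S} :=
  relpre val e.
Arguments induced {V} e S.

Lemma client_wins_induced (b : nat) (VH : finType) (eH : rel VH) (A : {set VH})
    (V : finType) (e : rel V) (S : {set V}) x :
  x \in S -> forces b (has_copy eH A e) set0 S -> client_wins b eH A (induced e S).
Proof.
move=> xS winS; rewrite client_winsE.
have valT : [set val u | u in [set: {x | x \in S}]] = S.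
  apply/setP => z; apply/imsetP/idP => [[u _ ->]|zS]; first exact: valP.
  by exists (Sub z zS); rewrite ?SubK.
rewrite -valT -(imset0 (val : {x | x \in S} -> V)) (forces_imset _ _ _ _ val_inj) in winS.
by apply: forces_sub winS => C; apply: has_copy_relpre (Sub x xS) val_inj.
Qed.

Section SparseGraph.
Variables (V : finType) (e : rel V).
Hypothesis simple_e : simple_graph e.

Lemma induced_simple (S : {set V}) : simple_graph (induced e S).
Proof. by have [sym_e irr_e] := simple_e; split=> *; [apply: sym_e | apply: irr_e]. Qed.

Lemma induced_component_tree x :
  ~ has_cycle (induced e (component e x)) -> is_tree (induced e (component e x)).
Proof.
set eC := induced e _ => acyclic.
have xx : x \in component e x by rewrite inE.
split; first by split=> //; apply: induced_simple.
split; first by apply/card_gt0P; exists (Sub x xx).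
move=> a c; apply/negPn/negP => not_ac.
have ac : connect e (val a) (val c).
  have := valP a; have := valP c; rewrite !inE => xc xa; apply: connect_trans xc.
  by rewrite simple_connect_sym.
pose S := val @: [set u | connect eC a u].
have [||_ [z [/imsetP[u + ->] zS euz]]] := connect_boundary_edge (S := S) ac.
- by rewrite mem_imset ?inE //; apply: val_inj.
- by rewrite mem_imset ?inE //; apply: val_inj.
rewrite inE => au; have zC := component_closed (valP u) euz.
case/negP: zS; apply/imsetP; exists (Sub z zC) => //.
by rewrite inE; apply: connect_trans au (connect1 _).
Qed.

(* Equivalently, every component is a tree on at most m vertices: the bounds rule
   out connected sets of m+1 vertices and cycles. *)
Definition sparse (m : nat) :=
  forall S : {set V}, 0 < #|S| <= m.+1 -> ndarts e S < 2 * minn #|S| m.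

Lemma sparse_component_leq m x : sparse m -> #|component e x| <= m.
Proof.
move=> sparse_e; rewrite leqNgt; apply/negP => big.
have [//|S [conS _ cardS]] := connected_subset_component simple_e (x := x) (n := m.+1).
by have := connected_set_ndarts simple_e conS; have := sparse_e S; rewrite cardS; lia.
Qed.

Lemma sparse_component_tree m x : sparse m -> is_tree (induced e (component e x)).
Proof.
move=> sparse_e; apply: induced_component_tree => /(has_cycle_ndarts (induced_simple _)).
case=> S S0; rewrite -(ndarts_imset (eV := e) S val_inj) // -(card_imset _ val_inj).
set A := imset _ _; have A0 : 0 < #|A| by rewrite card_gt0 imset_eq0.
have : #|A| <= m.
  apply: leq_trans (sparse_component_leq x sparse_e); apply: subset_leq_card.
  by apply/subsetP => _ /imsetP[u _ ->]; apply: valP.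
by have := sparse_e A; lia.
Qed.

Lemma homo_component_connect (VH : finType) (eH : rel VH) x (f : VH -> V) :
  {in component eH x &, {homo f : y z / eH y z >-> e y z}} ->
  {in component eH x, forall z, connect e (f x) (f z)}.
Proof.
move=> homf z; rewrite inE => xz; apply/negPn/negP => not_conn.
pose S := [set w in component eH x | connect e (f x) (f w)].
have [||a [c [+ cS eac]]] := connect_boundary_edge (S := S) xz.
- by rewrite !inE !connect0.
- by rewrite inE (negPf not_conn) andbF.
rewrite inE => /andP[ax fxa]; have cx := component_closed ax eac.
case/negP: cS; rewrite inE cx; apply: connect_trans fxa (connect1 _).
exact: homf.
Qed.

Lemma has_copy_in_class (VH : finType) (eH : rel VH) x (C : {set V}) :
  has_copy eH (component eH x) e C ->
  exists k, has_copy eH (component eH x) e (C :&: fingraph.root e @^-1: [set k]).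
Proof.
have sym_c := simple_connect_sym simple_e.
move=> /has_copyP[f [fC injf homf]]; exists (fingraph.root e (f x)).
apply/has_copyP; exists f; split=> // z zx; rewrite inE fC //= !inE.
by rewrite (root_connect sym_c) sym_c (homo_component_connect homf).
Qed.

Lemma waiter_wins_sparse (b m : nat) (VH : finType) (eH : rel VH) x :
  winning_trees_exceed b eH (component eH x) m -> sparse m -> ~~ client_wins b eH setT e.
Proof.
move=> large sparse_e; have sym_c := simple_connect_sym simple_e.
rewrite client_winsE.
apply: contraNN (_ : ~~ forces b (has_copy eH (component eH x) e) set0 setT).
  by apply: forces_sub => C; apply: has_copy_subset (subsetT _).
apply: (waiter_wins_classwise (r := fingraph.root e)) => [C|k]; first exact: has_copy_in_class.
rewrite /forces_on set0I setTI.
have [->|/set0Pn[y]] := eqVneq (fingraph.root e @^-1: [set k]) set0.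
  rewrite forces0; apply/negP => /has_copyP[f [/(_ x) + _ _]].
  by rewrite !inE connect0 => /(_ isT).
rewrite !inE => /eqP yk; have -> : fingraph.root e @^-1: [set k] = component e y.
  by apply/setP => z; rewrite !inE -yk root_connect // sym_c.
apply/negP => /(client_wins_induced (x := y)); rewrite inE connect0 => /(_ isT).
move/(large _ _ (sparse_component_tree y sparse_e)).
by rewrite card_sig ltnNge sparse_component_leq.
Qed.

End SparseGraph.

(** * Disjoint unions of hosts *)

Section DisjointUnion.
Variables (K : finType) (T : K -> finType) (e : forall k, rel (T k)).

Definition disjoint_union : rel {k & T k} :=
  fun u w => (tag u == tag w) && e (tagged u) (tagged_as u w).

Lemma disjoint_union_Tagged k (a c : T k) : disjoint_union (Tagged T a) (Tagged T c) = e a c.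
Proof. by rewrite /disjoint_union eqxx /= tagged_asE. Qed.

Lemma disjoint_union_simple : (forall k, simple_graph (@e k)) -> simple_graph disjoint_union.
Proof.
move=> simple_e; split=> [[k a] [l c]|[k a]]; last first.
  by rewrite disjoint_union_Tagged; have [_ ->] := simple_e k.
have [kl|kl] := eqVneq k l; last by rewrite /disjoint_union /= [l == k]eq_sym (negPf kl).
by case: l / kl c => c; rewrite !disjoint_union_Tagged; have [->] := simple_e k.
Qed.

Lemma sum_disjoint_union (S : {set {k & T k}}) (F : {k & T k} -> nat) :
  \sum_(u in S) F u = \sum_k \sum_(a : T k | Tagged T a \in S) F (Tagged T a).
Proof.
rewrite (sig_big_dep predT (fun (k : K) (a : T k) => Tagged T a \in S)
  (fun k a => F (Tagged T a))).
by apply: eq_big => -[k a].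
Qed.

Lemma disjoint_union_ndarts m (S : {set {k & T k}}) :
  (forall k, is_tree (@e k)) -> (forall k, #|T k| <= m.+1) ->
  m.+1 * ndarts disjoint_union S <= m * (2 * #|S|).
Proof.
move=> tree_e small; pose X k := [set a : T k | Tagged T a \in S].
have -> : ndarts disjoint_union S = \sum_k ndarts (@e k) (X k).
  rewrite /ndarts sum_disjoint_union; apply: eq_bigr => k _.
  apply: eq_big => [a|a _]; first by rewrite inE.
  rewrite sum_disjoint_union (bigD1 k) //= [X in _ + X]big1 ?addn0 => [|l lk].
    by apply: eq_big => [c|c _]; rewrite ?inE ?disjoint_union_Tagged.
  by rewrite big1 // => c _; rewrite /disjoint_union /= eq_sym (negPf lk).
have -> : #|S| = \sum_k #|X k|.
  rewrite -sum1_card sum_disjoint_union; apply: eq_bigr => k _.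
  by rewrite -sum1_card; apply: eq_bigl => a; rewrite inE.
rewrite !big_distrr /=; apply: leq_sum => k _.
have [->|X0] := eqVneq (X k) set0; first by rewrite ndarts0 muln0.
have Xm : #|X k| <= m.+1 := leq_trans (max_card (mem (X k))) (small k).
have : m.+1 * (ndarts (@e k) (X k) + 2) <= m.+1 * (2 * #|X k|).
  by rewrite leq_mul2l tree_ndarts.
by move: (ndarts _ _) #|X k| Xm => q x; nia.
Qed.

End DisjointUnion.

Lemma client_wins_host_copies (b v : nat) (VH : finType) (eH : rel VH)
    (T : VH -> finType) (e : forall x, rel (T x)) :
  simple_graph eH -> (forall x, client_wins b eH (component eH x) (e x)) ->
  (forall x, #|T x| <= v) ->
  exists M, forall (V : finType) (eG : rel V) (f : {k : VH * 'I_M & T k.1} -> V),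
    injective f ->
    {homo f : u w / disjoint_union (fun k : VH * 'I_M => e k.1) u w >-> eG u w} ->
    client_wins b eH setT eG.
Proof.
move=> simple_H winT small; have [M win_each] := forces_board_of_each_type b v 0 VH.
exists M => V eG f injf homf.
pose place (k : VH * 'I_M) (a : T k.1) := f (Tagged (fun k : VH * 'I_M => T k.1) a).
pose B k := place k @: setT.
have disjB : disjoint_family B.
  move=> k l kl; rewrite -setI_eq0; apply/eqP/setP => z; rewrite !inE.
  apply/negP => /andP[/imsetP[a _ ->] /imsetP[c _ /injf /(congr1 tag) /= kl']].
  by rewrite kl' eqxx in kl.
have winB k : winning_board b v (fun C => has_copy eH (component eH k.1) eG (C :&: B k)) (B k).
  have injk : injective (place k) by move=> a c /injf/eqP; rewrite eq_Tagged => /eqP.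
  have [a c eac|mono_k card_k win_k] := winning_board_image (eG := eG) injk _ (winT k.1).
    by apply: homf; rewrite disjoint_union_Tagged.
  by split=> //; apply: leq_trans card_k (small k.1).
rewrite client_winsE.
apply: forces_sub (win_each V B _ predT set0 disjB winB _ _ _ _) => // [C /forallP copies|||k].
- have /fin_all_exists[i copy_i] x := existsP (copies x).
  apply: (has_copy_components (D := fun x => B (x, i x)) simple_H) => // x y xy.
  by apply: disjB; apply: contraNneq xy => -[->].
- by rewrite forces0.
- by rewrite cards0.
by rewrite disjoints_subset sub0set.
Qed.

(** * Random subsets *)

Section RandomSubset.
Local Open Scope ring_scope.
Import Order.TTheory GRing.Theory Num.Theory.
Variables (R : realFieldType) (T : finType).
Implicit Types (p : R) (S E : {set T}) (Q : pred {set T}) (X : {set T} -> R).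

Definition bernoulli_mass p E : R := p ^+ #|E| * (1 - p) ^+ (#|T| - #|E|).

Definition Pr p Q : R := \sum_(E | Q E) bernoulli_mass p E.

Definition Ex p X : R := \sum_E bernoulli_mass p E * X E.

Lemma bernoulli_mass_prod p E : bernoulli_mass p E = \prod_t (if t \in E then p else 1 - p).
Proof.
rewrite (bigID (mem E)) /= (eq_bigr (fun=> p)); last by move=> t ->.
rewrite prodr_const; congr (_ * _).
rewrite (eq_bigr (fun=> 1 - p)); last by move=> t /negPf ->.
by rewrite prodr_const -(cardC (mem E)) addKn.
Qed.

Lemma bernoulli_mass_ge0 p E : 0 <= p <= 1 -> 0 <= bernoulli_mass p E.
Proof. by move=> /andP[p0 p1]; rewrite mulr_ge0 ?exprn_ge0 // subr_ge0. Qed.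

Lemma Pr_superset p S : Pr p (fun E => S \subset E) = p ^+ #|S|.
Proof.
have : \prod_t (p + (if t \in S then 0 else 1 - p)) = \sum_(E in {set T})
    \prod_t (if t \in E then p else if t \in S then 0 else 1 - p).
  exact: bigA_distr.
rewrite (eq_bigr (fun t => if t \in S then p else 1)); last first.
  by move=> t _; case: ifP => _; rewrite ?addr0 // addrC subrK.
rewrite -big_mkcond prodr_const => ->.
rewrite /Pr [RHS](bigID (fun E : {set T} => S \subset E)) /= [X in _ = _ + X]big1 ?addr0.
  apply: eq_bigr => E /subsetP SE; rewrite bernoulli_mass_prod; apply: eq_bigr => t _.
  by case: ifP => // tE; case: ifP => // /SE; rewrite tE.
by move=> E /subsetPn[t tS tE]; rewrite (bigD1 t) //= (negPf tE) tS mul0r.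
Qed.

Lemma PrT p : Pr p predT = 1.
Proof.
by rewrite -[RHS](expr0 p) -(cards0 T) -Pr_superset; apply: eq_bigl => E; rewrite sub0set.
Qed.

Lemma Pr_ge0 p Q : 0 <= p <= 1 -> 0 <= Pr p Q.
Proof. by move=> p01; apply: sumr_ge0 => E _; apply: bernoulli_mass_ge0. Qed.

Lemma Pr_predC p Q : Pr p (predC Q) = 1 - Pr p Q.
Proof. by rewrite -(PrT p) /Pr [X in X - _](bigID Q) /= addrAC subrr add0r. Qed.

Lemma Pr_mono p Q Q' : 0 <= p <= 1 -> (forall E, Q E -> Q' E) -> Pr p Q <= Pr p Q'.
Proof.
move=> p01 QQ'; rewrite /Pr [leRHS](bigID Q) /= (eq_bigl Q) => [|E]; last first.
  by case QE: (Q E); rewrite ?andbF ?QQ'.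
by rewrite lerDl; apply: sumr_ge0 => E _; apply: bernoulli_mass_ge0.
Qed.

Lemma Pr_exists p (I : finType) (P : pred I) (Q : I -> pred {set T}) : 0 <= p <= 1 ->
  Pr p (fun E => [exists (i | P i), Q i E]) <= \sum_(i | P i) Pr p (Q i).
Proof.
move=> p01; rewrite /Pr (exchange_big_dep predT) //= big_mkcond.
apply: ler_sum => E _; have mass_ge0 := bernoulli_mass_ge0 E p01.
case: exists_inP => [[i Pi Qi]|_]; last exact: sumr_ge0.
by rewrite (bigD1 i) /= ?Pi // lerDl sumr_ge0.
Qed.

Lemma Pr_card_setI p S n : 0 <= p <= 1 ->
  Pr p (fun E => n <= #|E :&: S|)%N <= 2 ^+ #|S| * p ^+ n.
Proof.
move=> p01; have /andP[p0 _] := p01.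
pose small (D : {set T}) := (D \subset S) && (#|D| == n).
apply: (@le_trans _ _ (Pr p (fun E => [exists (D | small D), D \subset E]))).
  apply: Pr_mono => // E /exists_subset_card[D]; rewrite subsetI => /andP[DE DS] cardD.
  by apply/exists_inP; exists D; rewrite // /small DS cardD /=.
apply: le_trans (Pr_exists _ _ p01) _.
rewrite (eq_bigr (fun=> p ^+ n)) => [|D /andP[_ /eqP <-]]; last exact: Pr_superset.
rewrite sumr_const -[leLHS]mulr_natl ler_wpM2r ?exprn_ge0 // -natrX ler_nat.
rewrite -card_powerset; apply: subset_leq_card; apply/subsetP => D /andP[DS _].
by rewrite inE.
Qed.

Lemma Ex_indicator p Q : Ex p (fun E => (Q E)%:R) = Pr p Q.
Proof.
by rewrite /Pr big_mkcond; apply: eq_bigr => E _; case: (Q E); rewrite ?mulr1 ?mulr0.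
Qed.

Lemma Ex_sum p (I : finType) (X : I -> {set T} -> R) :
  Ex p (fun E => \sum_i X i E) = \sum_i Ex p (X i).
Proof. by rewrite exchange_big; apply: eq_bigr => E _; rewrite mulr_sumr. Qed.

Lemma ExMr p X c : Ex p (fun E => X E * c) = Ex p X * c.
Proof. by rewrite mulr_suml; apply: eq_bigr => E _; rewrite mulrA. Qed.

Lemma variance_ge_Pr p Q X : 0 <= p <= 1 -> (forall E, Q E -> X E = 0) ->
  Pr p Q * Ex p X ^+ 2 <= Ex p (fun E => X E ^+ 2) - Ex p X ^+ 2.
Proof.
move=> p01 X0; set mu := Ex p X.
have -> : Ex p (fun E => X E ^+ 2) - mu ^+ 2 = Ex p (fun E => (X E - mu) ^+ 2).
  rewrite [RHS](eq_bigr (fun E => bernoulli_mass p E * X E ^+ 2 +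
     (- (2 * mu)) * (bernoulli_mass p E * X E) + mu ^+ 2 * bernoulli_mass p E));
    last by move=> E _; ring.
  rewrite !big_split /= -!mulr_sumr -/(Pr p predT) PrT -/(Ex p X) -/mu.
  by rewrite -/(Ex p (fun E => X E ^+ 2)); ring.
rewrite /Pr mulr_suml /Ex [leRHS](bigID Q) /= -[leLHS]addr0; apply: lerD.
  by apply: ler_sum => E /X0 ->; rewrite sub0r sqrrN.
by apply: sumr_ge0 => E _; rewrite mulr_ge0 ?bernoulli_mass_ge0 // sqr_ge0.
Qed.

(* Chebyshev's inequality for the sum of the indicators of the events that S_i is
   included in the random set, each divided by its probability. *)
Lemma Pr_no_subset p (I : finType) (S : I -> {set T}) : 0 < p <= 1 ->
  Pr p (fun E => [forall i, ~~ (S i \subset E)]) * #|I|%:R ^+ 2 <=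
  \sum_i \sum_j (p ^- #|S i :&: S j| - 1).
Proof.
move=> /andP[p0 p1]; have p01 : 0 <= p <= 1 by rewrite ltW.
have pn0 n : p ^+ n != 0 by rewrite expf_neq0 // gt_eqF.
pose X E : R := \sum_i (S i \subset E)%:R * p ^- #|S i|.
have ExX : Ex p X = #|I|%:R.
  rewrite Ex_sum (eq_bigr (fun=> 1)) ?sumr_const // => i _.
  by rewrite ExMr Ex_indicator Pr_superset mulfV.
have ExX2 : Ex p (fun E => X E ^+ 2) = \sum_i \sum_j p ^- #|S i :&: S j|.
  have -> : Ex p (fun E => X E ^+ 2) = Ex p (fun E => \sum_i \sum_j
      (S i :|: S j \subset E)%:R * (p ^- #|S i| * p ^- #|S j|)).
    apply: eq_bigr => E _; rewrite expr2 mulr_suml; congr (_ * _).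
    apply: eq_bigr => i _; rewrite mulr_sumr; apply: eq_bigr => j _.
    by rewrite mulrACA -natrM mulnb subUset.
  rewrite Ex_sum; apply: eq_bigr => i _; rewrite Ex_sum; apply: eq_bigr => j _.
  rewrite ExMr Ex_indicator Pr_superset -invfM -exprD -cardsUI exprD.
  by rewrite invfM mulVKf.
apply: (@le_trans _ _ (Ex p (fun E => X E ^+ 2) - Ex p X ^+ 2)).
  rewrite -[in leLHS]ExX; apply: variance_ge_Pr => // E /forallP none.
  by rewrite /X big1 // => i _; rewrite (negPf (none i)) mul0r.
rewrite ExX ExX2 [leRHS](eq_bigr (fun i => \sum_j p ^- #|S i :&: S j| - #|I|%:R)).
  by rewrite sumrB sumr_const -[_%:R *+ _]mulr_natr expr2.
by move=> i _; rewrite sumrB sumr_const.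
Qed.

End RandomSubset.

(** * Edge sets of labelled graphs *)

Lemma ndarts_ord (n : nat) (e : rel 'I_n) (S : {set 'I_n}) : simple_graph e ->
  ndarts e S = 2 * \sum_(i in S) \sum_(j in S) ((i < j) && e i j).
Proof.
move=> [sym_e irr_e]; set half := (X in 2 * X).
have halfC : half = \sum_(i in S) \sum_(j in S) ((j < i) && e i j).
  rewrite /half exchange_big; apply: eq_bigr => i _; apply: eq_bigr => j _.
  by rewrite sym_e.
rewrite mul2n -addnn {2}halfC -big_split; apply: eq_bigr => i _ /=.
rewrite -big_split; apply: eq_bigr => j _ /=.
by case: ltngtP => [||/val_inj->] /=; rewrite ?addn0 ?irr_e.
Qed.

Section Gadj.
Variable (n : nat).
Implicit Types (E : {set epair n}) (S : {set 'I_n}).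

Definition epairs_in S : {set epair n} := [set u | ((val u).1 \in S) && ((val u).2 \in S)].

Lemma gadj_simple E : simple_graph (gadj E).
Proof.
split=> [i j|i]; first by apply: eq_existsb => u; rewrite orbC.
apply/existsP => -[u /andP[_]]; rewrite orbb => /andP[/eqP ui /eqP uj].
by have := valP u; rewrite /= ui uj ltnn.
Qed.

Lemma gadj_epair E (u : epair n) : gadj E (val u).1 (val u).2 = (u \in E).
Proof.
apply/exists_inP/idP => [[w wE /orP[]/andP[/eqP w1 /eqP w2]]|uE].
- suff -> : u = w by [].
  by apply: val_inj; rewrite [LHS]surjective_pairing -w1 -w2 -surjective_pairing.
- by have := valP u; have := valP w; rewrite -w1 -w2 => /ltnW; rewrite leqNgt => /negPf->.
by exists u; rewrite // !eqxx.
Qed.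

Lemma card_epairs_in S : #|epairs_in S| <= #|S| * #|S|.
Proof.
rewrite -cardsX -(card_imset _ val_inj); apply: subset_leq_card.
by apply/subsetP => _ /imsetP[u + ->]; rewrite !inE.
Qed.

Lemma ndarts_gadj E S : ndarts (gadj E) S = 2 * #|E :&: epairs_in S|.
Proof.
rewrite ndarts_ord; last exact: gadj_simple.
rewrite -(card_imset _ val_inj) -sum1_card pair_big big_mkcond [in RHS]big_mkcond /=.
congr (2 * _); apply: eq_bigr => -[i j] _ /=.
have [ij|ji] := ltnP i j; last first.
  rewrite if_same; case: imsetP => // -[[[i' j'] /= ij'] _ [Ei Ej]].
  by rewrite leqNgt Ei Ej ij' in ji.
have -> : ((i, j) \in [set val u | u in E :&: epairs_in S]) =
    ((Sub (i, j) ij : epair n) \in E :&: epairs_in S).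
  by rewrite -(mem_imset _ _ val_inj).
rewrite !inE /= -gadj_epair /=.
by case: gadj; case: ifP.
Qed.

End Gadj.

Section CopyEdges.
Variables (U : finType) (e : rel U) (n : nat).
Hypothesis simple_e : simple_graph e.
Implicit Types (f g : U -> 'I_n) (A : {set U}) (E : {set epair n}).

Definition copy_edges f : {set epair n} :=
  [set u | [exists a, exists c, [&& e a c, f a == (val u).1 & f c == (val u).2]]].

Lemma copy_edgesP f (u : epair n) :
  reflect (exists a c, [/\ e a c, f a = (val u).1 & f c = (val u).2]) (u \in copy_edges f).
Proof.
rewrite inE; apply: (iffP existsP) => [[a /existsP[c /and3P[eac /eqP fa /eqP fc]]]|].
  by exists a, c.
by move=> [a [c [eac fa fc]]]; exists a; apply/existsP; exists c; rewrite eac fa fc !eqxx.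
Qed.

Lemma gadj_copy_edges f E a c : injective f -> copy_edges f \subset E ->
  e a c -> gadj E (f a) (f c).
Proof.
have [sym_e irr_e] := simple_e; move=> injf /subsetP subE.
have ordered a' c' : f a' < f c' -> e a' c' -> gadj E (f a') (f c').
  move=> fac eac; rewrite (gadj_epair E (Sub (f a', f c') fac)).
  by apply/subE/copy_edgesP; exists a', c'.
have [gadj_sym _] := gadj_simple E.
move=> eac; have [fac|fac|/val_inj/injf ac] := ltngtP (f a) (f c).
- exact: ordered.
- by rewrite gadj_sym; apply: ordered; rewrite // sym_e.
- by rewrite ac irr_e in eac.
Qed.

Lemma gadj_copy_edgesE f a c : injective f -> gadj (copy_edges f) (f a) (f c) = e a c.
Proof.
have [sym_e _] := simple_e; move=> injf; apply/idP/idP; last exact: gadj_copy_edges.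
move=> /exists_inP[u /copy_edgesP[a' [c' [eac <- <-]]]].
case/orP => /andP[/eqP/injf <- /eqP/injf <-] //.
by rewrite sym_e.
Qed.

Lemma card_copy_edges_in f A : injective f ->
  ndarts e A = 2 * #|copy_edges f :&: epairs_in (f @: A)|.
Proof.
move=> injf; rewrite -ndarts_gadj; apply/esym/ndarts_imset => // a c.
exact: gadj_copy_edgesE.
Qed.

Lemma card_copy_edgesI f g : injective f -> (forall a c, f a = g c -> a = c) ->
  ndarts e [set a | f a == g a] = 2 * #|copy_edges f :&: copy_edges g|.
Proof.
move=> injf fg; rewrite (card_copy_edges_in _ injf); congr (2 * #|pred_of_set _|).
apply/setP => u; rewrite !in_setI; apply: andb_id2l => /copy_edgesP[a [c [eac fa fc]]].
rewrite [in LHS]inE -fa -fc !mem_imset // !inE.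
apply/andP/existsP => [[/eqP ga /eqP gc]|[a' /existsP[c' /and3P[_ /eqP ga /eqP gc]]]].
  by exists a; apply/existsP; exists c; rewrite eac -ga -gc -fa -fc !eqxx.
have -> : g a = f a by rewrite [in g a](fg a a') ?ga.
have -> : g c = f c by rewrite [in g c](fg c c') ?gc.
by rewrite !eqxx.
Qed.

End CopyEdges.

(** * Moments in the random graph *)

Section DenseSets.
Local Open Scope ring_scope.
Import Order.TTheory GRing.Theory Num.Theory.

Lemma Pr_dense_set (R : realFieldType) (n w q : nat) (p : R) : 0 <= p <= 1 ->
  Pr p (fun E : {set epair n} =>
     [exists (S : {set 'I_n} | #|S| == w), (2 * q <= ndarts (gadj E) S)%N]) <=
  2 ^+ (w * w) * (n%:R ^+ w * p ^+ q).
Proof.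
move=> p01; have /andP[p0 _] := p01; apply: le_trans (Pr_exists _ _ p01) _.
apply: (@le_trans _ _ (\sum_(S : {set 'I_n} | #|S| == w) 2 ^+ (w * w) * p ^+ q)).
  apply: ler_sum => S /eqP Sw.
  apply: (@le_trans _ _ (Pr p (fun E : {set epair n} => q <= #|E :&: epairs_in S|)%N)).
    by apply: Pr_mono => // E; rewrite ndarts_gadj leq_pmul2l.
  apply: le_trans (Pr_card_setI _ _ p01) _; rewrite ler_wpM2r ?exprn_ge0 //.
  by apply: ler_weXn2l; rewrite ?ler1n // -Sw card_epairs_in.
rewrite sumr_const -[leLHS]mulr_natr -mulrA ler_wpM2l ?exprn_ge0 //.
rewrite mulrC ler_wpM2r ?exprn_ge0 // -natrX ler_nat.
apply: leq_trans (bin_leq_exp n w); rewrite -[n in 'C(n, _)]card_ord -card_draws.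
by apply: subset_leq_card; apply/subsetP => S; rewrite !inE.
Qed.

End DenseSets.

Section LabelledCopies.
Local Open Scope ring_scope.
Import Order.TTheory GRing.Theory Num.Theory.
Variables (R : realFieldType) (U : finType) (e : rel U) (s n : nat) (g : U * 'I_s -> 'I_n).
Hypotheses (simple_e : simple_graph e) (injg : injective g) (s_gt0 : (0 < s)%N).
Implicit Types (x y : {ffun U -> 'I_s}) (A : {set U}) (p L : R).

(* Vertex a of U gets its own s places g (a, i) and a labelling chooses one of them;
   so two copies share exactly the edges inside the agreement of their labellings. *)
Definition labelled_copy x : {set epair n} := copy_edges e (fun a => g (a, x a)).

Definition agreement x y : {set U} := [set a | x a == y a].

Lemma labelling_inj x : injective (fun a => g (a, x a)).
Proof. by move=> a c /injg[]. Qed.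

Lemma card_labelled_copyI x y :
  ndarts e (agreement x y) = (2 * #|labelled_copy x :&: labelled_copy y|)%N.
Proof.
rewrite -(card_copy_edgesI simple_e (@labelling_inj x)) => [|a c /injg[] //].
by congr ndarts; apply/setP => a; rewrite !inE (inj_eq injg) -pair_eqE /= eqxx.
Qed.

Lemma card_agreeing x A : (#|[set y | A \subset agreement x y]| * s ^ #|A| = s ^ #|U|)%N.
Proof.
pose allowed a : pred 'I_s := if a \in A then pred1 (x a) else predT.
have -> : #|[set y | A \subset agreement x y]| = #|(family allowed)|.
  apply: eq_card => y; rewrite inE; apply/subsetP/familyP => agree a.
    by rewrite /allowed; case: ifP => // /agree; rewrite !inE eq_sym.
  by move=> aA; have := agree a; rewrite /allowed aA !inE eq_sym.
rewrite card_family foldrE big_image /= (bigID (mem A)) /= big1 ?mul1n => [|a aA].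
  rewrite (eq_bigr (fun=> s)) => [|a /negPf aA]; last by rewrite /allowed aA card_ord.
  rewrite prod_nat_const -expnD addnC; congr (_ ^ _)%N.
  by rewrite -(cardC (mem A)).
by rewrite /allowed aA card1.
Qed.

Section Overlap.
Variables (p L : R).
Hypotheses (p01 : 0 < p <= 1) (L_gt0 : 0 < L).
(* s ^+ #|A| * p ^+ k is the expected number of labelled copies of the subgraph of e
   induced on A, which has k edges. *)
Hypothesis copies_dense : forall A k, ndarts e A = (2 * k)%N -> (0 < k)%N ->
  L <= s%:R ^+ #|A| * p ^+ k.

Lemma sum_overlap_agreement x A :
  \sum_(y | agreement x y == A) (p ^- #|labelled_copy x :&: labelled_copy y| - 1) <=
  s%:R ^+ #|U| / L.
Proof.
have /andP[p0 p1] := p01; have [k Ak] : exists k, ndarts e A = (2 * k)%N.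
  by eexists; apply: card_copy_edges_in (@labelling_inj x).
have rhs0 : 0 <= s%:R ^+ #|U| / L by rewrite divr_ge0 ?exprn_ge0 ?ler0n // ltW.
rewrite (eq_bigr (fun=> p ^- k - 1)) => [|y /eqP xy]; last first.
  by do 3!congr (_ _ _); have := card_labelled_copyI x y; rewrite xy; lia.
have [->|k0] := posnP k; first by rewrite big1 // => y _; rewrite invr1 subrr.
have pk1 : 1 <= p ^- k by rewrite invf_ge1 ?exprn_gt0 // exprn_ile1 // ltW.
rewrite ler_pdivlMr //; apply: (@le_trans _ _
  (#|[set y | A \subset agreement x y]|%:R * p ^- k * (s%:R ^+ #|A| * p ^+ k))).
  apply: ler_pM => //.
  - by apply: sumr_ge0 => y _; rewrite subr_ge0.
  - exact: ltW.
  - rewrite sumr_const -[leLHS]mulr_natl; apply: ler_pM; rewrite ?ler0n //.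
    + by rewrite subr_ge0.
    + rewrite ler_nat; apply: subset_leq_card; apply/subsetP => y xyA.
      by have /eqP <- : agreement x y == A := xyA; rewrite in_set.
    by rewrite lerBlDr lerDl.
  exact: copies_dense.
rewrite mulrACA mulVf ?mulr1; last by rewrite expf_neq0 // gt_eqF.
by rewrite -natrX -natrM card_agreeing natrX.
Qed.

Lemma Pr_no_labelled_copy :
  Pr p (fun E => [forall x, ~~ (labelled_copy x \subset E)]) <= 2 ^+ #|U| / L.
Proof.
have sU0 : 0 < s%:R ^+ #|U| :> R by rewrite exprn_gt0 ?ltr0n.
rewrite -(ler_pM2r (exprn_gt0 2 sU0)).
have := Pr_no_subset labelled_copy p01; rewrite card_ffun card_ord natrX => /le_trans; apply.
apply: (@le_trans _ _ (\sum_(x : {ffun U -> 'I_s}) \sum_(A : {set U}) s%:R ^+ #|U| / L)).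
  apply: ler_sum => x _; rewrite (partition_big (agreement x) predT) //=.
  by apply: ler_sum => A _; apply: sum_overlap_agreement.
have cardU : #|{set U}| = (2 ^ #|U|)%N by rewrite -[LHS]cardsT -powersetT card_powerset cardsT.
rewrite !sumr_const card_ffun card_ord cardU -[leLHS]mulr_natr.
rewrite -[X in X * _ <= _]mulr_natr !natrX.
suff -> : s%:R ^+ #|U| / L * 2 ^+ #|U| * s%:R ^+ #|U| =
    2 ^+ #|U| / L * (s%:R ^+ #|U|) ^+ 2 :> R by [].
by ring.
Qed.

End Overlap.
End LabelledCopies.

(** * The threshold *)

Section Asymptotics.
Local Open Scope ring_scope.
Import Order.TTheory GRing.Theory Num.Theory.

Lemma Pr_client_wins_leq (F : realFieldType) (b : nat) (VH : finType) (eH : rel VH) x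
    (m n : nat) (p : F) :
  winning_trees_exceed b eH (component eH x) m -> 0 <= p <= 1 ->
  Pr p (fun E : {set epair n} => client_wins b eH setT (gadj E)) <=
  \sum_(w < m.+2 | (0 < w)%N) 2 ^+ (w * w) * (n%:R ^+ w * p ^+ minn w m).
Proof.
move=> large p01; pose dense (w : nat) (E : {set epair n}) :=
  [exists (S : {set 'I_n} | #|S| == w), (2 * minn w m <= ndarts (gadj E) S)%N].
apply: (@le_trans _ _ (Pr p (fun E => [exists (w : 'I_m.+2 | (0 < w)%N), dense w E]))).
  apply: Pr_mono => // E; apply: contraTT => not_dense.
  apply: (waiter_wins_sparse (gadj_simple E) large) => S /andP[S0 Sm].
  rewrite ltnNge; apply: contra not_dense => dense_S; apply/existsP; exists (inord #|S|).
  by rewrite inordK ?ltnS // S0; apply/existsP; exists S; rewrite eqxx.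
apply: le_trans (Pr_exists _ _ p01) _.
by apply: ler_sum => w _; apply: Pr_dense_set.
Qed.

Lemma gnp_probE (n : nat) (p : R) (Q : pred {set epair n}) : gnp_prob p Q = Pr p Q.
Proof.
rewrite /gnp_prob /Pr; apply: eq_bigr => E _.
by rewrite /bernoulli_mass cardsT !RpowE.
Qed.

Lemma whp_Pr (Q : forall n : nat, pred {set epair n}) (p : nat -> R) : prob_bounds p ->
  (forall eps : R, 0 < eps -> exists N : nat, forall n, (N <= n)%N ->
     Pr (p n) (predC (Q n)) <= eps) -> whp Q p.
Proof.
move=> pb small eps /RltP eps0; have [|N small_n] := small (eps / 2); first by rewrite divr_gt0.
exists N => n /ssrnat.leP Nn; apply/RltP; rewrite RdistE gnp_probE distrC -[R1]/(1 : R).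
rewrite -Pr_predC ger0_norm ?Pr_ge0 //; last by have [/RleP -> /RleP ->] := pb n.
by apply: le_lt_trans (small_n n Nn) _; rewrite ltr_pdivrMr // ltr_pMr // ltr1n.
Qed.

Section Threshold.
Variables (v e n : nat).
Hypotheses (e_gt0 : (0 < e)%N) (n_gt0 : (0 < n)%N).

Lemma threshold_gt0 : 0 < threshold v e n.
Proof. by apply/RltP; apply: exp_pos. Qed.

Lemma threshold_power (w q : nat) :
  n%:R ^+ w * threshold v e n ^+ q = Rpower n%:R (w%:R - q%:R * (v%:R / e%:R))%R.
Proof.
have nR : Rlt R0 (INR n) by apply: lt_0_INR; apply/ssrnat.ltP.
rewrite -!INRE -!RpowE -!Rpower_pow //; last exact: exp_pos.
rewrite /threshold Rpower_mult -RmultE -Rpower_plus; congr Rpower.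
by rewrite RplusE RmultE RoppE RdivE; ring.
Qed.

Let n_ge1 : Rle 1 n%:R.
Proof. by apply/RleP; rewrite ler1n. Qed.

Lemma threshold_power_le1 w q : (e * w <= v * q)%N -> n%:R ^+ w * threshold v e n ^+ q <= 1.
Proof.
move=> wq; rewrite threshold_power -[leRHS](Rpower_O n%:R); last first.
  by apply: Rlt_le_trans n_ge1; apply: Rlt_0_1.
apply/RleP/Rle_Rpower => //; apply/RleP.
by rewrite subr_le0 mulrA ler_pdivlMr ?ltr0n // -!natrM ler_nat mulnC [(q * v)%N]mulnC.
Qed.

Lemma threshold_power_ge1 w q : (v * q <= e * w)%N -> 1 <= n%:R ^+ w * threshold v e n ^+ q.
Proof.
move=> qw; rewrite threshold_power -[leLHS](Rpower_O n%:R); last first.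
  by apply: Rlt_le_trans n_ge1; apply: Rlt_0_1.
apply/RleP/Rle_Rpower => //; apply/RleP.
by rewrite subr_ge0 mulrA ler_pdivrMr ?ltr0n // -!natrM ler_nat mulnC [(w * e)%N]mulnC.
Qed.

Lemma power_below_threshold w q (d p : R) : 0 <= p -> 0 <= d <= 1 -> (0 < q)%N ->
  (e * w <= v * q)%N -> p <= d * threshold v e n -> n%:R ^+ w * p ^+ q <= d.
Proof.
move=> p0 /andP[d0 d1] q0 wq pd; have t0 := ltW threshold_gt0.
apply: (@le_trans _ _ (d ^+ q * (n%:R ^+ w * threshold v e n ^+ q))).
  rewrite mulrCA ler_wpM2l ?exprn_ge0 ?ler0n // -exprMn.
  by apply: lerXn2r; rewrite ?nnegrE ?mulr_ge0.
apply: (@le_trans _ _ (d ^+ q)); last by rewrite -[leRHS]expr1; apply: ler_wiXn2l.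
by rewrite -[leRHS]mulr1 ler_wpM2l ?exprn_ge0 // threshold_power_le1.
Qed.

Lemma power_above_threshold s w q u (d L p : R) : 0 <= p -> 1 <= d -> 1 <= L ->
  (0 < q)%N -> (v * q <= e * w)%N -> (w <= u)%N -> n%:R <= s%:R * d ->
  L * d ^+ u * threshold v e n <= p -> L <= s%:R ^+ w * p ^+ q.
Proof.
move=> p0 d1 L1 q0 wq wu ns Lp; have t0 := ltW threshold_gt0.
have L0 : 0 <= L by apply: le_trans L1.
have d0 : 0 < d by apply: lt_le_trans d1.
have Ld1 : 1 <= L * d ^+ u by rewrite mulr_ege1 ?exprn_ege1.
rewrite -(ler_pM2r (exprn_gt0 w d0)).
apply: (@le_trans _ _ (n%:R ^+ w * p ^+ q)); last first.
  rewrite mulrAC -exprMn ler_wpM2r ?exprn_ge0 //.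
  by apply: lerXn2r; rewrite ?nnegrE ?mulr_ge0 ?ler0n // ltW.
apply: (@le_trans _ _ ((L * d ^+ u) ^+ q * (n%:R ^+ w * threshold v e n ^+ q))); last first.
  rewrite mulrCA ler_wpM2l ?exprn_ge0 ?ler0n // -exprMn.
  by apply: lerXn2r; rewrite ?nnegrE ?mulr_ge0 ?exprn_ge0 // ltW.
apply: (@le_trans _ _ (L * d ^+ u)); first by rewrite ler_wpM2l // ler_weXn2l.
rewrite -[leLHS]mulr1; apply: ler_pM; rewrite ?threshold_power_ge1 //.
  by apply: le_trans Ld1.
by rewrite -[leLHS]expr1 ler_weXn2l.
Qed.

End Threshold.

Lemma waiter_wins_whp (b : nat) (VH : finType) (eH : rel VH) x (m : nat) (p : nat -> R) :
  winning_trees_exceed b eH (component eH x) m -> (0 < m)%N ->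
  prob_bounds p -> little_o p (threshold m.+1 m) ->
  whp (fun n (E : {set epair n}) => ~~ client_wins b eH setT (gadj E)) p.
Proof.
move=> large m0 pb below; apply: whp_Pr => // eps eps0.
pose c : R := \sum_(w < m.+2 | (0 < w)%N) 2 ^+ (w * w).
have c0 : 0 < c.
  by rewrite /c (bigD1 ord_max) //= ltr_pwDl ?exprn_gt0 // sumr_ge0 // => w _; rewrite exprn_ge0.
pose d : R := Num.min 1 (eps / c).
have d0 : 0 < d by rewrite lt_min ltr01 divr_gt0.
have [|N pd] := below d; first exact/RltP.
exists N.+1 => n Nn; have /RleP pn := pd n (ltnW Nn).
have [/RleP p0 /RleP p1] := pb n; have p01 : 0 <= p n <= 1 by rewrite p0.
apply: (@le_trans _ _ (Pr (p n) (fun E : {set epair n} => client_wins b eH setT (gadj E)))).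
  by apply: Pr_mono => // E /=; rewrite negbK.
apply: le_trans (Pr_client_wins_leq n large p01) _.
apply: (@le_trans _ _ (c * d)); last by rewrite mulrC -ler_pdivlMr // ge_min lexx orbT.
rewrite mulr_suml; apply: ler_sum => w w0; rewrite ler_wpM2l ?exprn_ge0 //.
apply: (@power_below_threshold m.+1 m n) => //; rewrite ?(leq_ltn_trans _ Nn) //.
- by rewrite (ltW d0) ge_min lexx.
- by rewrite leq_min w0.
by have := ltn_ord w; rewrite minnE; nia.
Qed.

Section WinningHosts.
Variables (b m : nat) (VH : finType) (eH : rel VH) (T : VH -> finType).
Variable e : forall x, rel (T x).
Hypotheses (m_gt0 : (0 < m)%N) (simple_H : simple_graph eH).
Hypothesis tree_e : forall x, is_tree (@e x).
Hypothesis win_e : forall x, client_wins b eH (component eH x) (@e x).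
Hypothesis small : forall x, (#|T x| <= m.+1)%N.

(* With u vertices on all the boards, each vertex gets n %/ u.+1 >= n / (2 * u.+1) places. *)
Lemma Pr_waiter_wins_leq :
  exists u : nat, forall (n : nat) (p L : R), (u < n)%N -> 0 < p <= 1 -> 1 <= L ->
    L * (2 * u.+1)%N%:R ^+ u * threshold m.+1 m n <= p ->
    Pr p (fun E : {set epair n} => ~~ client_wins b eH setT (gadj E)) <= 2 ^+ u / L.
Proof.
have [M hosts] := client_wins_host_copies simple_H win_e small.
pose U : finType := {k : VH * 'I_M & T k.1}.
pose eU : rel U := disjoint_union (fun k : VH * 'I_M => @e k.1).
have simple_U : simple_graph eU.
  by apply: disjoint_union_simple => k; have [[]] := tree_e k.1.
exists #|U| => n p L Un p01 L1 large_p; have /andP[p0 p1] := p01.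
have L0 : 0 < L by apply: lt_le_trans L1.
have n0 : (0 < n)%N by apply: leq_ltn_trans Un.
pose s := (n %/ #|U|.+1)%N; have s0 : (0 < s)%N by rewrite divn_gt0.
have [g injg] : exists g : U * 'I_s -> 'I_n, injective g.
  by apply: exists_injection_ord; rewrite card_prod card_ord /s; nia.
apply: le_trans (Pr_no_labelled_copy (g := g) simple_U injg s0 p01 L0 _).
  apply: Pr_mono => [|E]; first by rewrite ltW.
  apply: contraR; rewrite negb_forall => /existsP[x]; rewrite negbK => copyE.
  apply: (hosts _ _ (fun a => g (a, x a))) => [|u w euw]; first exact: labelling_inj.
  by apply: gadj_copy_edges copyE euw => //; apply: labelling_inj.
move=> A k Ak k0.
apply: (power_above_threshold m_gt0 n0 (ltW p0) _ L1 k0 _ _ _ large_p).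
- by rewrite ler1n.
- have := @disjoint_union_ndarts _ _ (fun k : VH * 'I_M => @e k.1) m A.
  by rewrite -/eU Ak !(mulnCA _ 2) leq_pmul2l //; apply.
- exact: max_card.
by rewrite -natrM ler_nat /s; nia.
Qed.

Lemma client_wins_whp (p : nat -> R) :
  prob_bounds p -> little_omega p (threshold m.+1 m) ->
  whp (fun n (E : {set epair n}) => client_wins b eH setT (gadj E)) p.
Proof.
move=> pb above; apply: whp_Pr => // eps eps0.
have [u waiter_leq] := Pr_waiter_wins_leq.
pose L : R := Num.max 1 (2 ^+ u / eps); pose c := L * (2 * u.+1)%N%:R ^+ u.
have L1 : 1 <= L by rewrite le_max lexx.
have L0 : 0 < L by apply: lt_le_trans L1.
have c0 : 0 < c by rewrite mulr_gt0 // exprn_gt0 // ltr0n.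
have [|N large_p] := above c; first exact/RltP.
exists (N + u.+1)%N => n Nn; have [/RleP p0 /RleP p1] := pb n.
have /RleP cp : Rle (Rmult c (threshold m.+1 m n)) (p n) by apply: large_p; lia.
apply: le_trans (waiter_leq n (p n) L _ _ L1 cp) _; first by lia.
  by rewrite p1 andbT; apply: lt_le_trans cp; rewrite mulr_gt0 ?threshold_gt0.
by rewrite ler_pdivrMr // mulrC -ler_pdivrMr // le_max lexx orbT.
Qed.

End WinningHosts.
End Asymptotics.

Theorem theorem10 :
  (* (1) trees *)
  (forall (b : nat) (VH : finType) (eH : rel VH),
      0 < b -> is_tree eH ->
      exists (VT : finType) (eT : rel VT), is_tree eT /\ client_wins b eH setT eT)
  /\
  (* (2) forests in G(n,p) *)
  (forall (b : nat) (VH : finType) (eH : rel VH),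
      0 < b -> is_forest eH -> (exists x y, eH x y) ->
      forall (VT : finType) (eT : rel VT),
        (* T_max: a minimum winning tree for some component ... *)
        (exists x : VH, min_winning_tree b eH (component eH x) eT) ->
        (* ... with the maximum number of vertices among these *)
        (forall (x : VH) (VT' : finType) (eT' : rel VT'),
            min_winning_tree b eH (component eH x) eT' -> #|VT'| <= #|VT|) ->
        forall p : nat -> R,
          prob_bounds p ->
          (little_omega p (threshold #|VT| (nedges eT)) ->
             whp (fun n E => client_wins b eH setT (gadj E)) p) /\
          (little_o p (threshold #|VT| (nedges eT)) ->
             whp (fun n E => ~~ client_wins b eH setT (gadj E)) p)).
Proof.
split=> [b VH eH _ treeH|b VH eH _ forestH [x0 [y0 x0y0]] VT eT [x [treeT winT minT]] maxT p pb].
  exact: connected_set_winning_tree treeH.1 (tree_connected_set treeH).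
have [simple_H _] := forestH.
have hosts z : exists (T : finType) (e : rel T),
    [/\ is_tree e, client_wins b eH (component eH z) e & #|T| <= #|VT|].
  have [T [e minTz]] := min_winning_tree_exists b forestH (component_connected_set simple_H z).
  by exists T, e; have [tree_e win_e _] := minTz; split=> //; apply: maxT minTz.
have [T /fin_all_exists[e /all_and3[tree_e win_e small]]] := fin_all_exists hosts.
have cardT := nedges_tree treeT; rewrite cardT in minT small *.
have nedges_gt0 : 0 < nedges eT.
  rewrite -ltnS; apply: leq_trans (component_gt1 simple_H x0y0) _.
  exact: leq_trans (client_wins_card (win_e x0)) (small x0).
by split; [apply: client_wins_whp win_e small p pb | apply: waiter_wins_whp minT _ pb].
Qed.
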